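(* Let $\Sigma$ be a $C^3$ smooth horizontal curve in $\mathbb{H}$, and let $x=\Sigma(0)$. Set $\gamma=\pi\circ\Sigma$ and denote by $k=k_\gamma$ the planar curvature of $\gamma$. Then, as $r\to0^+$, $$\mathcal{S}^1(B_H(x,r)\cap\Sigma)=2r+\mathbf{a}_1(x)r^3+o(r^3),$$ where $\mathbf{a}_1(x)$ is a positive multiple of $k(0)^2$ (i.e. $\mathbf a_1(x)=\kappa\,k(0)^2$ with $\kappa>0$ a constant).
   Context: The first Heisenberg group $\mathbb{H}$ is $\mathbb{R}^3$ with the group law $(x_1,x_2,x_3)*(y_1,y_2,y_3)=(x_1+y_1,\,x_2+y_2,\,x_3+y_3-2x_1y_2+2x_2y_1)$. It is equipped with the Korányi metric $d_H(x,y)=\|x^{-1}*y\|_H$, where $\|(x_1,x_2,x_3)\|_H^4=(x_1^2+x_2^2)^2+x_3^2$. $B_H(x,r)$ is the closed $d_H$-ball with center $x$ and radius $r$. The projection $\pi:\mathbb{H}\to\mathbb{R}^2$ is $\pi(x_1,x_2,x_3)=(x_1,x_2)$. Curves are one-dimensional embedded submanifolds of $\mathbb{R}^3$ given by regular parameterizations $\Sigma:I\to\mathbb{H}$ on an open interval $I$ (here $0\in I$); $\Sigma$ also denotes the image. The curve $\Sigma=(x_1,x_2,x_3)$ is horizontal if $\vartheta(\dot\Sigma)=\dot x_3+2x_1\dot x_2-2x_2\dot x_1=0$ identically. The planar curvature is $k_\gamma=(\dot x_1\ddot x_2-\dot x_2\ddot x_1)/|\dot\gamma|^3$. $\mathcal{S}^1$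 is the $1$-dimensional spherical Hausdorff measure of $(\mathbb{H},d_H)$ (defined by coverings with $d_H$-balls), normalized so that the $\mathcal{S}^1$-measure of a horizontal curve equals its Carnot–Carathéodory length $\int_I(\dot x_1^2+\dot x_2^2)^{1/2}\,ds$. *)

(* Defs.v *)
From HB Require Import structures.
From mathcomp Require Import all_boot all_order all_algebra.
From mathcomp Require Import all_classical all_reals all_analysis.
From mathcomp Require Import ring.

Set Implicit Arguments.
Unset Strict Implicit.
Unset Printing Implicit Defensive.

Import Order.TTheory GRing.Theory Num.Theory.
Import numFieldNormedType.Exports.

Local Open Scope classical_set_scope.
Local Open Scope ring_scope.

Section Heisenberg.
Context {R : realType}.

(* R^3 as an iterated product, carrying its usual topology; a point is
   ((x1, x2), x3). *)
Local Notation H := (R * R * R)%type.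

Definition co1 (x : H) : R := x.1.1.
Definition co2 (x : H) : R := x.1.2.
Definition co3 (x : H) : R := x.2.

Definition hmul (x y : H) : H :=
  (co1 x + co1 y, co2 x + co2 y,
   co3 x + co3 y - 2 * co1 x * co2 y + 2 * co2 x * co1 y).

Definition hone : H := (0, 0, 0).

Definition hinv (x : H) : H := (- co1 x, - co2 x, - co3 x).

Lemma hmulA : associative hmul.
Proof.
move=> x y z; rewrite /hmul /co1 /co2 /co3 /=.
by congr (_, _, _); ring.
Qed.

Lemma hmul1x : left_id hone hmul.
Proof.
move=> [[x1 x2] x3]; rewrite /hmul /hone /co1 /co2 /co3 /=.
by congr (_, _, _); ring.
Qed.

Lemma hmulVx : left_inverse hone hinv hmul.
Proof.
move=> x; rewrite /hmul /hinv /hone /co1 /co2 /co3 /=.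
by congr (_, _, _); ring.
Qed.

Definition hnorm (x : H) : R :=
  Num.sqrt (Num.sqrt ((co1 x ^+ 2 + co2 x ^+ 2) ^+ 2 + co3 x ^+ 2)).

Lemma hnorm4 (x : H) :
  hnorm x ^+ 4 = (co1 x ^+ 2 + co2 x ^+ 2) ^+ 2 + co3 x ^+ 2.
Proof.
rewrite (exprM _ 2 2) sqr_sqrtr ?sqrtr_ge0// sqr_sqrtr//.
by rewrite addr_ge0// sqr_ge0.
Qed.

Definition hdist (x y : H) : R := hnorm (hmul (hinv x) y).

Definition hball (x : H) (r : R) : set H := [set y | hdist x y <= r].

(* Radius 0 is allowed (hball c 0 is the singleton of c and contributes 0), so
   that finite coverings are among the countable ones. *)
Definition ball_cover (delta : R) (A : set H) (c : nat -> H) (r : nat -> R) :=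
  (forall i, 0 <= r i <= delta) /\ A `<=` \bigcup_i hball (c i) (r i).

(* A ball of radius r is counted with weight 2 * r, its diameter. This is the
   normalization for which a horizontal curve has measure equal to its
   Carnot-Caratheodory length: a horizontal line through the centre of a ball
   of radius r meets this ball in a segment of length 2 * r. *)
Definition spherical_pre (delta : R) (A : set H) : \bar R :=
  ereal_inf [set s | exists c : nat -> H, exists r : nat -> R,
    ball_cover delta A c r /\ s = (\sum_(0 <= i <oo) (2 * r i)%:E)%E].

Definition spherical1 (A : set H) : \bar R :=
  ereal_sup [set spherical_pre delta A | delta in [set d : R | 0 < d]].

(* As I is always open below, the two-sided derivatives of the library at
   points of I do not depend on the values of f outside I. *)
Definition class_C (n : nat) (I : set R) (f : R -> R) : Prop :=
  forall t, I t ->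
    (forall k, (k < n)%N -> derivable (derive1n k f) t 1) /\
    {for t, continuous (derive1n n f)}.

Definition class_C_curve (n : nat) (I : set R) (Sigma : R -> H) : Prop :=
  [/\ class_C n I (co1 \o Sigma), class_C n I (co2 \o Sigma) &
      class_C n I (co3 \o Sigma)].

Definition regular (I : set R) (Sigma : R -> H) : Prop :=
  forall t, I t ->
    (derive1 (co1 \o Sigma) t, derive1 (co2 \o Sigma) t,
     derive1 (co3 \o Sigma) t) <> (0, 0, 0).

Definition homeo_onto_image (I : set R) (Sigma : R -> H) : Prop :=
  {within I, continuous Sigma} /\
  exists g : H -> R, (forall t, I t -> g (Sigma t) = t) /\
    {within Sigma @` I, continuous g}.

(* The image of I under Sigma is then an embedded one-dimensional submanifold
   of R^3 with global parameterization Sigma. *)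
Definition embedded_curve (n : nat) (I : set R) (Sigma : R -> H) : Prop :=
  [/\ class_C_curve n I Sigma, regular I Sigma & homeo_onto_image I Sigma].

Definition horizontal (I : set R) (Sigma : R -> H) : Prop :=
  forall t, I t ->
    derive1 (co3 \o Sigma) t
    + 2 * co1 (Sigma t) * derive1 (co2 \o Sigma) t
    - 2 * co2 (Sigma t) * derive1 (co1 \o Sigma) t = 0.

Definition hproj (x : H) : R * R := (co1 x, co2 x).

Definition planar_curvature (gamma : R -> R * R) (t : R) : R :=
  let g1 := fst \o gamma in
  let g2 := snd \o gamma in
  (derive1 g1 t * derive1n 2 g2 t - derive1 g2 t * derive1n 2 g1 t)
    / Num.sqrt (derive1 g1 t ^+ 2 + derive1 g2 t ^+ 2) ^+ 3.

End Heisenberg.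

(* Main.v *)
Require Import Defs.
From HB Require Import structures.
From mathcomp Require Import all_boot all_order all_algebra.
From mathcomp Require Import all_classical all_reals all_analysis.
From mathcomp Require Import ring lra.

Import Order.TTheory GRing.Theory Num.Theory.
Import numFieldNormedType.Exports.

Local Open Scope classical_set_scope.
Local Open Scope ring_scope.

(** Every ball of radius r projects into a disc of diameter 2r, so a covering of
    an arc by small balls costs at least the length of its projection, up to a
    factor tending to 1; conversely d_H(p s, p t) <= (1 + o(1)) |s - t| along the
    arc-length parametrization p of a horizontal curve, because the vertical
    component of (p s)^-1 * p t is O(|s - t|^3).  Hence S^1 of an arc is its length.

    With l the arc length measured from x and N = d_H(x, Sigma(t)), the Taylor
    expansion of the curve gives |pi(Sigma(t)) - pi(x)|^2 = l^2 - k^2 l^4 / 12 + o(l^4)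
    and a vertical component - k l^3 / 3 + o(l^3), so N^4 = l^4 - k^2 l^6 / 18 + o(l^6),
    that is l = N + k^2 N^3 / 72 + o(N^3).  The ball of radius r therefore cuts out an
    arc of length 2 (r + k^2 r^3 / 72) + o(r^3), and kappa = 1 / 36. *)

(** * The Korányi distance against its horizontal part, and monotonicity of the measure *)

Section spherical_measure.
Context {R : realType}.
Local Notation H := (R * R * R)%type.

(* [pdist2] and [hvert] are the squared length of the horizontal part and the
   vertical part of x^-1 * y. *)
Definition pdist2 (x y : H) : R :=
  (co1 y - co1 x) ^+ 2 + (co2 y - co2 x) ^+ 2.

Definition hvert (x y : H) : R :=
  co3 y - co3 x + 2 * co1 x * co2 y - 2 * co2 x * co1 y.

Lemma pdist2_ge0 (x y : H) : 0 <= pdist2 x y.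
Proof. by rewrite addr_ge0 ?sqr_ge0. Qed.

Lemma hdist_ge0 (x y : H) : 0 <= hdist x y.
Proof. exact: sqrtr_ge0. Qed.

Lemma hdist4 (x y : H) : hdist x y ^+ 4 = pdist2 x y ^+ 2 + hvert x y ^+ 2.
Proof.
rewrite /hdist hnorm4 /pdist2 /hvert /hmul /hinv /co1 /co2 /co3 /=; ring.
Qed.

Lemma pdist2_le_hdist (x y : H) : pdist2 x y <= hdist x y ^+ 2.
Proof.
rewrite -(@ler_pXn2r _ 2)// ?nnegrE ?pdist2_ge0 ?sqr_ge0//.
by rewrite -exprM hdist4 lerDl sqr_ge0.
Qed.

Lemma hdist_le (x y : H) (b : R) : 0 <= b ->
  pdist2 x y ^+ 2 + hvert x y ^+ 2 <= b ^+ 4 -> hdist x y <= b.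
Proof. by move=> b0; rewrite -hdist4 ler_pXn2r// nnegrE ?hdist_ge0. Qed.

(* Parallelogram law at c; this avoids the triangle inequality for [hdist]. *)
Lemma pdist2_ball (c x y : H) (r : R) :
  hball c r x -> hball c r y -> pdist2 x y <= (2 * r) ^+ 2.
Proof.
rewrite /hball /= => cx cy.
have r0 : 0 <= r by apply: le_trans cx; exact: hdist_ge0.
have sq z : hdist c z <= r -> pdist2 c z <= r ^+ 2.
  move=> cz; apply: le_trans (pdist2_le_hdist _ _) _.
  by rewrite ler_pXn2r// nnegrE ?hdist_ge0.
move: (sq _ cx) (sq _ cy); rewrite /pdist2 => h1 h2; rewrite exprMn.
have := sqr_ge0 (co1 x + co1 y - 2 * co1 c).
have := sqr_ge0 (co2 x + co2 y - 2 * co2 c).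
nra.
Qed.

Lemma spherical1_le (A B : set H) : A `<=` B -> (spherical1 A <= spherical1 B)%E.
Proof.
move=> AB; apply: ge_ereal_sup => _ [d d0 <-].
apply: (@le_trans _ _ (spherical_pre d B)); last first.
  by apply: ereal_sup_ubound; exists d.
apply: ereal_inf_le_tmp => s [c [r [[rd cov] ->]]]; exists c, r; split=> //.
by split=> //; exact: subset_trans AB cov.
Qed.

Lemma spherical1_ge0 (A : set H) : (0 <= spherical1 A)%E.
Proof.
apply: (@le_trans _ _ (spherical_pre 1 A)); last first.
  by apply: ereal_sup_ubound; exists 1 => //=.
apply: le_ereal_inf_tmp => s [c [r [[rd _] ->]]].
by apply: nneseries_ge0 => i _ _; rewrite lee_fin mulr_ge0//; have /andP[] := rd i.
Qed.

End spherical_measure.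

(** * Coverings by balls cost at least the length *)

Section lower_bound.
Context {R : realType}.
Local Notation H := (R * R * R)%type.

(** The sets [E i] may fail to be measurable, so each is enlarged to the closed interval of length
    [w i] starting at its infimum; countable subadditivity of Lebesgue measure then applies. *)
Lemma le_cover_itv (u v : R) (E : nat -> set R) (w : nat -> R) :
  (forall i, 0 <= w i) ->
  (forall i s s', E i s -> E i s' -> `|s - s'| <= w i) ->
  `[u, v] `<=` \bigcup_i E i ->
  ((v - u)%:E <= \sum_(0 <= i <oo) (w i)%:E)%E.
Proof.
move=> w0 Ew cov.
have [vu|uv] := ltP v u.
  apply: (@le_trans _ _ 0%:E); first by rewrite lee_fin subr_le0 ltW.
  by apply: nneseries_ge0 => i _ _; rewrite lee_fin.
pose I i := [set` `[inf (E i), inf (E i) + w i]].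
have EI i : E i `<=` I i.
  move=> s Es; rewrite /I /= in_itv /=.
  have lbE : lbound (E i) (s - w i).
    by move=> s' Es'; have := Ew _ _ _ Es Es'; rewrite ler_norml => /andP[_]; lra.
  apply/andP; split; first by apply: ge_inf => //; exists (s - w i).
  by rewrite -lerBlDr; apply: lb_le_inf => //; exists s.
have -> : (v - u)%:E = lebesgue_measure [set` `[u, v]].
  rewrite lebesgue_measure_itv /= lte_fin.
  by move: uv; rewrite le_eqVlt => /predU1P[->|->]; rewrite ?ltxx ?subrr.
have wE i : (w i)%:E = lebesgue_measure (I i).
  rewrite /I lebesgue_measure_itv /= lte_fin ltrDl.
  have := w0 i; rewrite le_eqVlt => /predU1P[<-|->]; first by rewrite ltxx.
  by rewrite -EFinB addrAC subrr add0r.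
under eq_eseriesr do rewrite wE.
apply: measure_sigma_subadditive => //.
  by move=> i; exact: measurable_itv.
by apply: (subset_trans cov); apply: subset_bigcup => i _; exact: EI.
Qed.

(** By [pdist2_ball], two parameters sent into the same ball of radius [r i] differ by at most
    [2 * r i / (1 - eps)], and the sets of such parameters cover the interval. The hypothesis is
    conditioned on a small projected distance because a ball gives no direct control of [s - t]. *)
Lemma le_spherical1 (p : R -> H) (u v : R) :
  (forall eps, 0 < eps < 1 -> exists2 h, 0 < h & forall s t,
     u <= s <= v -> u <= t <= v -> pdist2 (p s) (p t) <= h ^+ 2 ->
     (1 - eps) ^+ 2 * (s - t) ^+ 2 <= pdist2 (p s) (p t)) ->
  ((v - u)%:E <= spherical1 (p @` `[u, v]))%E.
Proof.
move=> hp; apply/lee_addgt0Pr => d d0.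
have [vu|uv] := leP v u.
  apply: (@le_trans _ _ 0%:E); first by rewrite lee_fin subr_le0.
  by rewrite adde_ge0 ?spherical1_ge0// lee_fin ltW.
(* Chosen so that the loss [eps * (v - u)] is at most [d]. *)
set eps := d / (d + (v - u)).
have den0 : 0 < d + (v - u) by rewrite addr_gt0// subr_gt0.
have eps01 : 0 < eps < 1.
  by rewrite /eps divr_gt0//= ltr_pdivrMr// mul1r ltrDl subr_gt0.
have [h h0 hh] := hp _ eps01.
have e1 : 0 < 1 - eps by case/andP: eps01 => _ ?; rewrite subr_gt0.
suff : (((1 - eps) * (v - u))%:E <= spherical1 (p @` `[u, v]))%E.
  rewrite -leeBlDr// -EFinB; apply: le_trans; rewrite lee_fin.
  have : eps * (v - u) <= d by rewrite /eps mulrAC ler_pdivrMr// ler_pM2l// lerDr ltW.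
  lra.
(* Radii at most [h / 2] bring any two curve points of one ball within the range of [hh]. *)
apply: (@le_trans _ _ (spherical_pre (h / 2) (p @` `[u, v]))); last first.
  by apply: ereal_sup_ubound; exists (h / 2) => //=; rewrite divr_gt0.
apply: le_ereal_inf_tmp => s [c [r [[rd cov] ->]]].
pose E i := [set s | u <= s <= v /\ hball (c i) (r i) (p s)].
have r0 i : 0 <= r i by case/andP: (rd i).
have Ew i s1 s2 : E i s1 -> E i s2 -> `|s1 - s2| <= (1 - eps)^-1 * (2 * r i).
  move=> [s1i B1] [s2i B2].
  have hd := pdist2_ball _ _ _ _ B1 B2.
  have hl : pdist2 (p s1) (p s2) <= h ^+ 2.
    apply: le_trans hd _; rewrite ler_pXn2r ?nnegrE ?mulr_ge0 ?(ltW h0)//.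
    by case/andP: (rd i) => _; lra.
  have := le_trans (hh _ _ s1i s2i hl) hd.
  rewrite -(real_normK (num_real (s1 - s2))) -exprMn.
  rewrite ler_pXn2r ?nnegrE ?mulr_ge0 ?normr_ge0 ?(ltW e1)// => ?.
  by rewrite ler_pdivlMl.
have covE : `[u, v]%classic `<=` \bigcup_i E i.
  move=> t /=; rewrite in_itv /= => tuv.
  have [|i _ B] := cov (p t); first by exists t => //=; rewrite in_itv.
  by exists i.
have w0 i : 0 <= (1 - eps)^-1 * (2 * r i).
  by rewrite mulr_ge0 ?mulr_ge0// invr_ge0 ltW.
have := le_cover_itv _ _ _ _ w0 Ew covE.
under eq_eseriesr do rewrite EFinM.
rewrite nneseriesZl; last by move=> i _; rewrite lee_fin mulr_ge0.
by rewrite lee_pdivlMl// EFinM.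
Qed.

End lower_bound.

(** * Efficient coverings by balls centred on the curve *)

Section upper_bound.
Context {R : realType}.
Local Notation H := (R * R * R)%type.

Lemma spherical_pre_ncover (delta rho : R) (A : set H) (n : nat) (c : nat -> H) :
  0 <= rho <= delta ->
  A `<=` \bigcup_(i in [set i | (i < n)%N]) hball (c i) rho ->
  (spherical_pre delta A <= (n%:R * (2 * rho))%:E)%E.
Proof.
move=> /andP[rho0 rhod] cov.
have d0 := le_trans rho0 rhod.
(* Balls of radius 0, which have weight 0, fill the sequence from index [n] on. *)
apply: ereal_inf_lbound; exists c, (fun i => if (i < n)%N then rho else 0); split.
  split; first by move=> i; case: ifP; rewrite ?lexx ?rho0.
  by move=> y /cov[i /= ni B]; exists i => //; rewrite ni.
rewrite (nneseries_split 0 n); last first.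
  by move=> k _; rewrite lee_fin mulr_ge0//; case: ifP.
rewrite eseries0 ?adde0; last first.
  by move=> i; rewrite add0n leqNgt => /negbTE -> _; rewrite mulr0.
rewrite add0n big_mkord (eq_bigr (fun=> (2 * rho)%:E)); last by move=> i _; rewrite ltn_ord.
by rewrite sumEFin sumr_const card_ord mulr_natl.
Qed.

(** The interval is cut into [n] pieces of width [w]. The image of each piece lies in the ball of
    radius [(1 + eps) * (w / 2)] about the image of its midpoint [m i], and the total weight is
    [(1 + eps) * (v - u)]. *)
Lemma spherical1_le_length (p : R -> H) (u v : R) : u <= v ->
  (forall eps, 0 < eps -> exists2 h, 0 < h & forall s t,
     u <= s <= v -> u <= t <= v -> `|s - t| <= h ->
     hdist (p s) (p t) <= (1 + eps) * `|s - t|) ->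
  (spherical1 (p @` `[u, v]) <= (v - u)%:E)%E.
Proof.
move=> uv hp; apply: ge_ereal_sup => _ [d d0 <-]; rewrite /= in d0.
apply/lee_addgt0Pr => e e0.
have vu0 : 0 <= v - u by rewrite subr_ge0.
set eps := e / (1 + (v - u)).
have den0 : 0 < 1 + (v - u) by rewrite ltr_pwDl.
have eps0 : 0 < eps by rewrite divr_gt0.
have [h h0 hh] := hp _ eps0.
have e1 : 0 < 1 + eps by rewrite addr_gt0.
(* The two summands ensure [w <= h] and [(1 + eps) * w <= d] respectively. *)
pose n := (Num.truncn ((v - u) / h + (1 + eps) * (v - u) / d)).+1.
have nP : (v - u) / h + (1 + eps) * (v - u) / d < n%:R by exact: truncnS_gt.
have n0 : 0 < n%:R :> R by rewrite ltr0n.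
have n0' : n%:R != 0 :> R by rewrite gt_eqF.
pose w := (v - u) / n%:R.
have w0 : 0 <= w by rewrite divr_ge0// ltW.
have nw : n%:R * w = v - u by rewrite /w mulrCA divff// mulr1.
have wh : w <= h.
  rewrite /w ler_pdivrMr// mulrC -ler_pdivrMr//; apply: ltW; apply: le_lt_trans nP.
  by rewrite lerDl divr_ge0 ?mulr_ge0 ?(ltW d0) ?(ltW e1).
have wd : (1 + eps) * w <= d.
  rewrite /w mulrA ler_pdivrMr// -ler_pdivrMl// mulrC.
  apply: ltW; apply: le_lt_trans nP.
  by rewrite lerDr divr_ge0// ltW.
pose m i := u + i%:R * w + w / 2.
apply: (@le_trans _ _ (n%:R * (2 * ((1 + eps) * (w / 2))))%:E).
  apply: (@spherical_pre_ncover _ _ _ _ (p \o m)).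
    rewrite mulr_ge0 ?(ltW e1) ?divr_ge0//=.
    by apply: le_trans wd; rewrite ler_pM2l//; lra.
  move=> _ [s suv <-]; move: suv; rewrite /= in_itv /= => /andP[us sv].
  have [i ni si] : exists2 i, (i < n)%N & `|m i - s| <= w / 2.
    move: w0; rewrite le_eqVlt => /predU1P[w0|w0].
      exists 0%N => //; rewrite /m -w0 !mul0r !addr0.
      have : s = u by apply/eqP; rewrite eq_le us andbT; move: nw; rewrite -w0; lra.
      by move->; rewrite subrr normr0.
    (* At the right endpoint the truncated quotient would be [n], one too many; the last piece is
       taken instead. *)
    have [sv'|sv'] := ltP s v; last first.
      exists n.-1 => //; rewrite /m.
      have : s = v by apply/eqP; rewrite eq_le sv.
      move=> ->.
      have -> : v = u + (n.-1%:R * w + w).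
        have : n%:R * w = n.-1%:R * w + w by rewrite -[in LHS]natr1 mulrDl mul1r.
        by rewrite nw; lra.
      by rewrite ler_norml; lra.
    have sw0 : 0 <= (s - u) / w by rewrite divr_ge0 ?subr_ge0 ?(ltW w0).
    exists (Num.truncn ((s - u) / w)).
      by rewrite (truncn_lt_nat _ sw0) ltr_pdivrMr// nw; lra.
    have /andP[] := truncn_itv sw0; rewrite /m; move: (Num.truncn _) => k.
    rewrite ler_pdivlMr// ltr_pdivrMr// -[k.+1%:R]natr1 mulrDl mul1r => h1 h2.
    by rewrite ler_norml; lra.
  exists i => //=; rewrite /hball /=.
  have mi : u <= m i <= v.
    rewrite /m; have iw : i.+1%:R * w <= v - u by rewrite -nw ler_wpM2r// ler_nat.
    move: iw; rewrite -natr1 mulrDl mul1r.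
    have : 0 <= i%:R * w by rewrite mulr_ge0.
    by lra.
  apply: (le_trans (hh _ _ mi _ _)); rewrite ?us//.
  - by apply: le_trans si _; lra.
  - by rewrite ler_pM2l.
rewrite lee_fin.
have -> : n%:R * (2 * ((1 + eps) * (w / 2))) = (v - u) + eps * (v - u).
  by rewrite -nw; field.
rewrite lerD2l /eps mulrAC ler_pdivrMr// ler_pM2l//; lra.
Qed.

End upper_bound.

(** * Measure of a curve that is isometric up to cubic errors *)

Section almost_isometry.
Context {R : realType}.
Local Notation H := (R * R * R)%type.

(** Cubic errors are negligible against [(s - t) ^+ 2], so both bounds above apply. The condition
    [4 * K * rho <= 1] gives [K * |s - t| <= 1 / 2] on the whole interval, so [pdist2] is at least
    half of [(s - t) ^+ 2] there: points with close projections have close parameters. *)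
Lemma spherical1_eq_length (p : R -> H) (K rho u v : R) :
  0 <= K -> 4 * K * rho <= 1 ->
  (forall s t, `|s| <= rho -> `|t| <= rho ->
     `|pdist2 (p s) (p t) - (s - t) ^+ 2| <= K * `|s - t| ^+ 3 /\
     `|hvert (p s) (p t)| <= K * `|s - t| ^+ 3) ->
  - rho <= u -> u <= v -> v <= rho ->
  spherical1 (p @` `[u, v]) = (v - u)%:E.
Proof.
move=> K0 Krho hp ru uv vr.
have inr s : u <= s <= v -> `|s| <= rho by rewrite ler_norml; lra.
have K1 : 0 < K + 1 by rewrite ltr_wpDl.
apply/eqP; rewrite eq_le; apply/andP; split.
- apply: spherical1_le_length => // e e0.
  (* Both errors are then at most [e * D ^+ 2], and [(1 + e) ^+ 2 + e ^+ 2 <= (1 + e) ^+ 4]. *)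
  exists (e / (K + 1)); first by rewrite divr_gt0.
  move=> s t /inr sr /inr tr; have [] := hp _ _ sr tr.
  rewrite -(real_normK (num_real (s - t))).
  have := normr_ge0 (s - t); move: `|s - t| => D D0.
  move=> /ler_normlP[_ hP] /[dup] hv /ler_normlP[hv1 hv2]; rewrite ler_pdivlMr// => De.
  have KD : K * D <= e by nra.
  apply: hdist_le; first by rewrite mulr_ge0// addr_ge0// ltW.
  have KD0 : 0 <= K * D by rewrite mulr_ge0.
  have h1 : pdist2 (p s) (p t) ^+ 2 <= (D ^+ 2 * (1 + e)) ^+ 2.
    rewrite ler_pXn2r ?nnegrE ?pdist2_ge0 ?mulr_ge0 ?sqr_ge0 ?addr_ge0 ?(ltW e0)//.
    have : K * D ^+ 3 <= D ^+ 2 * e.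
      by rewrite exprS mulrA mulrC ler_wpM2l// sqr_ge0.
    by rewrite mulrDr mulr1; lra.
  have h2 : hvert (p s) (p t) ^+ 2 <= (D ^+ 2 * e) ^+ 2.
    rewrite -(real_normK (num_real (hvert _ _))).
    rewrite ler_pXn2r ?nnegrE ?normr_ge0 ?mulr_ge0 ?sqr_ge0 ?(ltW e0)//.
    have : K * D ^+ 3 <= D ^+ 2 * e.
      by rewrite exprS mulrA mulrC ler_wpM2l// sqr_ge0.
    exact: le_trans.
  apply: le_trans (lerD h1 h2) _.
  rewrite -subr_ge0.
  have -> : ((1 + e) * D) ^+ 4 - ((D ^+ 2 * (1 + e)) ^+ 2 + (D ^+ 2 * e) ^+ 2)
          = D ^+ 4 * (2 * e + 4 * e ^+ 2 + 4 * e ^+ 3 + e ^+ 4) by ring.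
  by rewrite mulr_ge0 ?exprn_ge0// !addr_ge0 ?mulr_ge0 ?exprn_ge0 ?(ltW e0).
- apply: le_spherical1 => e /andP[e0 e1].
  exists (e / (2 * (K + 1))); first by rewrite divr_gt0// mulr_gt0.
  set h := e / _; have hE : h * (2 * (K + 1)) = e.
    by rewrite /h divfK// gt_eqF// mulr_gt0.
  have h0 : 0 < h by rewrite divr_gt0// mulr_gt0.
  move=> s t /inr sr /inr tr; have [+ _] := hp _ _ sr tr.
  have D2r : `|s - t| <= 2 * rho.
    by apply: le_trans (ler_normB _ _) _; lra.
  rewrite -(real_normK (num_real (s - t))).
  move: D2r; have := normr_ge0 (s - t); move: `|s - t| => D D0 D2r.
  have := pdist2_ge0 (p s) (p t); set P := pdist2 _ _ => P0.
  move=> /ler_normlP[hP _] hPh.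
  have KD0 : 0 <= K * D by rewrite mulr_ge0.
  have low : (1 - K * D) * D ^+ 2 <= P.
    have -> : (1 - K * D) * D ^+ 2 = D ^+ 2 - K * D ^+ 3 by ring.
    by lra.
  have KD : K * D <= 1 / 2 by nra.
  (* Otherwise [P >= D ^+ 2 / 2 > h ^+ 2]. *)
  have Dh : D <= 2 * h.
    rewrite leNgt; apply/negP => hD.
    have : (1 / 2) * D ^+ 2 <= (1 - K * D) * D ^+ 2.
      by rewrite ler_wpM2r ?sqr_ge0//; lra.
    have : 0 < (D - 2 * h) * (D + 2 * h) by apply: mulr_gt0; lra.
    have : 0 < h ^+ 2 by rewrite exprn_gt0.
    nra.
  apply: le_trans low; rewrite ler_wpM2r ?sqr_ge0//.
  have : K * D <= e by rewrite -hE; nra.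
  nra.
Qed.

End almost_isometry.

(** * Mean values and limits at 0 *)

Section calculus.
Context {R : realType}.

(** The mean value theorem freed from the order of [s] and [t]. The distance bounds on [xi] serve to
    compare the intermediate points found for different functions. *)
Lemma mvt_sym (f df : R -> R) (c s t : R) :
  (forall x : R, `|x| <= c -> is_derive x 1 f (df x)) ->
  `|s| <= c -> `|t| <= c ->
  exists xi, [/\ `|xi - s| <= `|t - s|, `|xi - t| <= `|t - s|, `|xi| <= c &
                 f t - f s = df xi * (t - s)].
Proof.
move=> fdf; wlog st : s t / s <= t.
  move=> H sc tc; have [st|ts] := leP s t; first exact: H.
  have [xi [h1 h2 h3 h4]] := H t s (ltW ts) tc sc.
  exists xi; split=> //; try by rewrite (distrC t s).
  by rewrite -opprB h4 -mulrN opprB.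
move=> sc tc; have inc x : s <= x <= t -> `|x| <= c.
  by move: sc tc; rewrite !ler_norml; lra.
have [||xi] := @MVT_segment R f df s t st.
- by move=> x /[!in_itv]/= /andP[h1 h2]; apply: fdf; rewrite inc// !ltW.
- apply: derivable_within_continuous => x; rewrite in_itv /= => /inc xc.
  by have [] := fdf x xc.
rewrite in_itv /= => xist E; exists xi; split=> //; last exact: inc.
  by rewrite !ger0_norm ?subr_ge0 ?lerD2r//; case/andP: xist.
rewrite distrC !ger0_norm ?subr_ge0 ?lerD2l ?lerN2//; case/andP: xist => //.
Qed.

Lemma near_punctured (P : R -> Prop) :
  (\forall x \near 0^', P x) <->
  exists2 d : R, 0 < d & forall x : R, x != 0 -> `|x| <= d -> P x.
Proof.
split=> [[d d0 hd]|[d d0 hd]].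
  exists (d / 2); first exact: divr_gt0.
  move=> x x0 xd; apply: hd => //=.
  by rewrite sub0r normrN (le_lt_trans xd)// ltr_pdivrMr// mulr_natr mulr2n ltrDl.
exists d => // x /=; rewrite sub0r normrN => /ltW xd x0; exact: hd.
Qed.

Lemma cvg_diff_quot0 (f : R -> R) (L : R) : is_derive (0 : R) (1 : R) f L ->
  (fun t => (f t - f 0) / t) @ 0^' --> L.
Proof.
move=> [df <-]; have := df; rewrite /derivable /derive => /cvg_ex[l fl].
rewrite (cvg_lim _ fl)//; apply: cvg_trans fl; apply: near_eq_cvg.
by near=> h => /=; rewrite addr0 /GRing.scale /= mulr1 mulrC.
Unshelve. all: by end_near. Qed.

(** Integrates a leading term, in the manner of l'Hôpital: the mean value theorem is applied to [g]
    minus its expected leading term. Since the limit is punctured, [dg 0 = 0] handles the case of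
    the intermediate point 0. *)
Lemma cvg_int_quot (g dg : R -> R) (c L : R) (n : nat) : 0 < c ->
  (forall x : R, `|x| <= c -> is_derive x 1 g (dg x)) -> g 0 = 0 -> dg 0 = 0 ->
  (fun t => dg t / t ^+ n.+1) @ 0^' --> L ->
  (fun t => g t / t ^+ n.+2) @ 0^' --> L / n.+2%:R.
Proof.
move=> c0 gdg g0 dg0 dgL; apply/cvgrPdist_le => e e0.
move/cvgrPdist_le: dgL => /(_ e e0) /near_punctured[d d0 hd].
apply/near_punctured; exists (Num.min c d); first by rewrite lt_min c0.
move=> t t0; rewrite le_min => /andP[tc td].
pose h := fun t => g t - L / n.+2%:R * t ^+ n.+2.
pose dh := fun t => dg t - L * t ^+ n.+1.
have hdh (x : R) : `|x| <= c -> is_derive x 1 h (dh x).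
  move=> xc; have gx := gdg x xc.
  have -> : h = g - (L / n.+2%:R) *: (@id R) ^+ n.+2.
    by apply/funext => y; rewrite !fctE.
  apply: is_derive_eq; rewrite /dh /GRing.scale /= mulr1.
  by rewrite mulrA divfK// pnatr_eq0.
have c00 : `|0 : R| <= c by rewrite normr0 ltW.
have [xi [xi1 _ xic]] := mvt_sym _ _ _ _ _ hdh c00 tc.
rewrite /h g0 expr0n /= mulr0 !subr0 => E.
have -> : L / n.+2%:R - g t / t ^+ n.+2 = - (dh xi * t / t ^+ n.+2).
  by rewrite -E mulrBl mulfK ?expf_neq0// opprB.
move: xi1; rewrite subr0 subr0 => xi1.
have xin : `|xi ^+ n.+1| <= `|t ^+ n.+1|.
  by rewrite !normrX ler_pXn2r ?nnegrE.
rewrite normrN [t ^+ n.+2]exprS invfM mulrA mulfK// normrM normfV.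
rewrite ler_pdivrMr ?normr_gt0 ?expf_neq0//.
apply: le_trans (_ : e * `|xi ^+ n.+1| <= _); last by rewrite ler_wpM2l// ltW.
have [->|xi0] := eqVneq xi 0.
  by rewrite /dh dg0 expr0n /= mulr0 subrr normr0 mulr0.
have := hd xi xi0 (le_trans xi1 td).
have xin0 : xi ^+ n.+1 != 0 by rewrite expf_neq0.
rewrite -(ler_pM2r (x := `|xi ^+ n.+1|)) ?normr_gt0// -normrM mulrBl divfK//.
by rewrite /dh distrC.
Qed.

End calculus.

(** * Cubic error estimates along a horizontal curve *)

Section horizontal_chart.
Context {R : realType}.
Local Notation H := (R * R * R)%type.
(** [(a1, a2)] is the planar velocity, [v] its length up to sign and [l] the arc length;
    horizontality is encoded in [d3]. *)
Context (Sigma : R -> H) (a1 a2 v l : R -> R) (c : R).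
Context (d1 : forall t : R, `|t| <= c -> is_derive t 1 (co1 \o Sigma) (a1 t)).
Context (d2 : forall t : R, `|t| <= c -> is_derive t 1 (co2 \o Sigma) (a2 t)).
Context (d3 : forall t : R, `|t| <= c -> is_derive t 1 (co3 \o Sigma)
  (2 * co2 (Sigma t) * a1 t - 2 * co1 (Sigma t) * a2 t)).
Context (dl : forall t : R, `|t| <= c -> is_derive t 1 l (v t)).
Context (v2 : forall t : R, `|t| <= c -> v t ^+ 2 = a1 t ^+ 2 + a2 t ^+ 2).

(** Horizontality eliminates the derivative of [co3] and leaves only increments of the projection:
    the vertical part is [-4] times the signed area swept by the chord of the projected curve from
    parameter [s]. *)
Lemma is_derive_hvert (s t : R) : `|t| <= c ->
  is_derive t 1 (fun u => hvert (Sigma s) (Sigma u))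
    (2 * ((co2 (Sigma t) - co2 (Sigma s)) * a1 t
          - (co1 (Sigma t) - co1 (Sigma s)) * a2 t)).
Proof.
move=> tc; have h1 := d1 t tc; have h2 := d2 t tc; have h3 := d3 t tc.
have -> : (fun u => hvert (Sigma s) (Sigma u)) =
  (co3 \o Sigma) - cst (co3 (Sigma s)) + (2 * co1 (Sigma s)) *: (co2 \o Sigma)
  - (2 * co2 (Sigma s)) *: (co1 \o Sigma).
  by apply/funext => u; rewrite !fctE.
apply: is_derive_eq (is_deriveB (is_deriveD (is_deriveB h3 (is_derive_cst _ _ _))
  (is_deriveZ _ h2)) (is_deriveZ _ h1)) _.
rewrite /GRing.scale /=; ring.
Qed.

Lemma hvertxx (x : H) : hvert x x = 0.
Proof. rewrite /hvert; ring. Qed.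

Context (B M : R) (M0 : 0 <= M).
Context (B1 : forall t, `|t| <= c -> `|a1 t| <= B).
Context (B2 : forall t, `|t| <= c -> `|a2 t| <= B).
Context (M1 : forall s t, `|s| <= c -> `|t| <= c -> `|a1 s - a1 t| <= M * `|s - t|).
Context (M2 : forall s t, `|s| <= c -> `|t| <= c -> `|a2 s - a2 t| <= M * `|s - t|).

(** After division by [(t - s) ^+ 2] both terms are sums of squares of velocity components, taken at
    intermediate points at most [2 * h] apart. Each component contributes
    [2 * B * (M * (2 * h))]. *)
Lemma pdist2_arc (s t : R) : `|s| <= c -> `|t| <= c ->
  `|pdist2 (Sigma s) (Sigma t) - (l s - l t) ^+ 2| <= 8 * B * M * `|s - t| ^+ 3.
Proof.
move=> sc tc.
have [x [xs xt xc E1]] := mvt_sym _ _ _ _ _ d1 sc tc.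
have [y [ys yt yc E2]] := mvt_sym _ _ _ _ _ d2 sc tc.
have [z [zs zt zc E3]] := mvt_sym _ _ _ _ _ dl sc tc.
rewrite /= in E1 E2; rewrite /pdist2 E1 E2 -[l s - _]opprB sqrrN E3.
rewrite !exprMn v2// -mulrDl -mulrBl normrM [`|s - t|]distrC.
set h := `|t - s| in xs ys zs xt yt zt *.
have h0 : 0 <= h by exact: normr_ge0.
have -> : `|(t - s) ^+ 2| = h ^+ 2 by rewrite normrX.
have -> : 8 * B * M * h ^+ 3 = 8 * B * M * h * h ^+ 2 by ring.
rewrite ler_wpM2r ?sqr_ge0//.
have est (a : R -> R) (x' z' : R) : (forall t, `|t| <= c -> `|a t| <= B) ->
    (forall s t, `|s| <= c -> `|t| <= c -> `|a s - a t| <= M * `|s - t|) ->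
    `|x'| <= c -> `|z'| <= c -> `|x' - s| <= h -> `|z' - s| <= h ->
    `|a x' ^+ 2 - a z' ^+ 2| <= 4 * B * M * h.
  move=> aB aM x'c z'c x's z's.
  rewrite subr_sqr normrM.
  have h1 : `|a x' - a z'| <= M * (2 * h).
    apply: le_trans (aM _ _ x'c z'c) _; rewrite ler_wpM2l//.
    have -> : x' - z' = (x' - s) - (z' - s) by ring.
    by apply: le_trans (ler_normB _ _) _; lra.
  have h2 : `|a x' + a z'| <= 2 * B.
    by apply: le_trans (ler_normD _ _) _; have := aB _ x'c; have := aB _ z'c; lra.
  apply: le_trans (ler_pM _ _ h1 h2) _ => //; lra.
have e1 := est a1 x z B1 M1 xc zc xs zs.
have e2 := est a2 y z B2 M2 yc zc ys zs.
rewrite opprD addrACA; apply: le_trans (ler_normD _ _) _; lra.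
Qed.

(** The mean value theorem is used for [hvert], then for each coordinate between [s] and [w]. The
    products [a1 w * a2 w] cancel, so a Lipschitz increment supplies the third factor [|t - s|].
    This yields the constant 4; 8 agrees with [pdist2_arc]. *)
Lemma hvert_arc (s t : R) : `|s| <= c -> `|t| <= c ->
  `|hvert (Sigma s) (Sigma t)| <= 8 * B * M * `|s - t| ^+ 3.
Proof.
move=> sc tc.
have [w [ws wt wc]] := mvt_sym _ _ _ _ _ (is_derive_hvert s) sc tc.
rewrite hvertxx subr0 => ->.
have [x [xs xw xc E1]] := mvt_sym _ _ _ _ _ d1 sc wc.
have [y [ys yw yc E2]] := mvt_sym _ _ _ _ _ d2 sc wc.
rewrite /= in E1 E2; rewrite E1 E2.
have -> : 2 * (a2 y * (w - s) * a1 w - a1 x * (w - s) * a2 w) * (t - s) =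
  2 * ((w - s) * ((a2 y - a2 w) * a1 w - (a1 x - a1 w) * a2 w)) * (t - s) by ring.
rewrite [`|s - t|]distrC.
have -> : 8 * B * M * `|t - s| ^+ 3 = 8 * B * M * `|t - s| ^+ 2 * `|t - s| by ring.
rewrite normrM ler_wpM2r// normrM normr_nat normrM.
have est (a b : R -> R) (u : R) : (forall t, `|t| <= c -> `|b t| <= B) ->
    (forall s t, `|s| <= c -> `|t| <= c -> `|a s - a t| <= M * `|s - t|) ->
    `|u| <= c -> `|u - w| <= `|w - s| ->
    `|(a u - a w) * b w| <= M * `|t - s| * B.
  move=> bB aM uc uw; rewrite normrM ler_pM// ?bB//.
  by apply: le_trans (aM _ _ uc wc) _; rewrite ler_wpM2l// (le_trans uw).
have e1 := est a2 a1 y B1 M2 yc yw.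
have e2 := est a1 a2 x B2 M1 xc xw.
set X := _ * a1 w in e1 *; set Y := _ * a2 w in e2 *.
have h0 := normr_ge0 (t - s); have := normr_ge0 (w - s).
have XY : `|X - Y| <= 2 * (M * `|t - s| * B).
  by apply: le_trans (ler_normB _ _) _; lra.
move=> w0; have := ler_pM w0 (normr_ge0 _) ws XY.
have B0 : 0 <= B by apply: le_trans (B1 _ wc).
have : 0 <= M * B * (`|t - s| ^+ 2) by rewrite !mulr_ge0// sqr_ge0.
lra.
Qed.

End horizontal_chart.

(** * Taylor expansion of arc length in terms of the Korányi distance *)

Section expansion.
Context {R : realType}.
Local Notation H := (R * R * R)%type.

Lemma cvg_punctured_eq (c L : R) (f g : R -> R) : 0 < c ->
  (forall t, t != 0 -> `|t| <= c -> f t = g t) ->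
  g @ 0^' --> L -> f @ 0^' --> L.
Proof.
move=> c0 fg; apply: cvg_trans; apply: near_eq_cvg.
by apply/near_punctured; exists c => // t t0 tc; rewrite fg.
Qed.

Lemma cvg_dnbhs0 : (fun t : R => t) @ 0^' --> (0 : R).
Proof. exact: nbhs_dnbhs. Qed.

Lemma cvg_sqrt_punctured (f : R -> R) (L : R) :
  f @ 0^' --> L -> (fun t => Num.sqrt (f t)) @ 0^' --> Num.sqrt L.
Proof. by move=> fL; apply: (cvg_comp _ _ fL); exact: sqrt_continuous. Qed.

(** Descends through sums, opposites and products to constants, [t] and limits in the context. The
    limit must have the same shape as the function, so the limits below are first rewritten with 0
    in place of [t]. *)
Ltac cvg_poly := cbv beta; first
  [ match goal with |- context [fmap (fun _ => ?k) _] => exact: (cvg_cst k) end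
  | match goal with |- context [fmap (fun t => t) _] => exact: cvg_dnbhs0 end
  | match goal with H : cvg_to _ (nbhs ?L) |- cvg_to _ (nbhs ?L') =>
      constr_eq L L'; exact: H end
  | match goal with
    | |- context [fmap (fun t => @GRing.add _ (@?f t) (@?g t)) _] => apply: cvgD; cvg_poly
    | |- context [fmap (fun t => @GRing.opp _ (@?f t)) _] => apply: cvgN; cvg_poly
    | |- context [fmap (fun t => @GRing.mul _ (@?f t) (@?g t)) _] => apply: cvgM; cvg_poly
    | |- context [fmap (@GRing.mul _ ?k) _] => exact: (cvgM (cvg_cst k) cvg_dnbhs0)
    end ].

Lemma cvg_taylor3 (f a : R -> R) (c b L : R) : 0 < c ->
  (forall t : R, `|t| <= c -> is_derive t 1 f (a t)) ->
  (fun t => (a t - a 0 - b * t) / t ^+ 2) @ 0^' --> L ->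
  (fun t => (f t - f 0 - a 0 * t - b / 2 * t ^+ 2) / t ^+ 3) @ 0^' --> L / 3.
Proof.
move=> c0 fa aL.
apply: (@cvg_int_quot _ (fun t => f t - f 0 - a 0 * t - b / 2 * t ^+ 2)
  (fun t => a t - a 0 - b * t) c L 1) => //; last 2 first.
- by rewrite expr0n /=; ring.
- by ring.
move=> t tc; have ft := fa t tc.
have -> : (fun t => f t - f 0 - a 0 * t - b / 2 * t ^+ 2) =
  f - cst (f 0) - a 0 *: (@id R) - (b / 2) *: (@id R) ^+ 2.
  by apply/funext => u; rewrite !fctE.
by apply: is_derive_eq; rewrite /GRing.scale /=; field.
Qed.

Lemma sqrt_sqrt_exp4 (x : R) : 0 <= x -> Num.sqrt (Num.sqrt (x ^+ 4)) = x.
Proof.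
by move=> x0; rewrite (exprM x 2 2) sqrtr_sqr ger0_norm ?sqr_ge0// sqrtr_sqr ger0_norm.
Qed.

Lemma hdistxx (x : H) : hdist x x = 0.
Proof.
have : hdist x x ^+ 4 == 0.
  by rewrite hdist4 hvertxx /pdist2 !subrr !expr0n /= !addr0 expr0n.
by rewrite expf_eq0 => /eqP.
Qed.

Context (Sigma : R -> H) (a1 a2 v l : R -> R) (c : R) (c0 : 0 < c).
Context (d1 : forall t : R, `|t| <= c -> is_derive t 1 (co1 \o Sigma) (a1 t)).
Context (d2 : forall t : R, `|t| <= c -> is_derive t 1 (co2 \o Sigma) (a2 t)).
Context (d3 : forall t : R, `|t| <= c -> is_derive t 1 (co3 \o Sigma)
  (2 * co2 (Sigma t) * a1 t - 2 * co1 (Sigma t) * a2 t)).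
Context (dl : forall t : R, `|t| <= c -> is_derive t 1 l (v t)).
Context (vE : forall t : R, `|t| <= c -> v t = Num.sqrt (a1 t ^+ 2 + a2 t ^+ 2)).
Context (l0 : l 0 = 0) (v0 : 0 < v 0).
(** [b1], [b2] play the role of the second derivatives at 0, and [e1], [e2] of half the third
    ones. *)
Context (b1 b2 e1 e2 : R).
Context (T1 : (fun t => (a1 t - a1 0 - b1 * t) / t ^+ 2) @ 0^' --> e1).
Context (T2 : (fun t => (a2 t - a2 0 - b2 * t) / t ^+ 2) @ 0^' --> e2).

Let N t := hdist (Sigma 0) (Sigma t).
(** The numerator of the planar curvature, so that [cr / A ^+ 3] is the curvature at 0. *)
Let cr := a1 0 * b2 - a2 0 * b1.
Let A := v 0.
(* [v t = A * (1 + p * t) + q * t ^+ 2 + o(t ^+ 2)], by squaring. *)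
Let p := (a1 0 * b1 + a2 0 * b2) / A ^+ 2.
Let q := (b1 ^+ 2 + b2 ^+ 2 + 2 * (a1 0 * e1 + a2 0 * e2) - A ^+ 2 * p ^+ 2) / (2 * A).
(** Like [u1], [u2] and [w] below, a normalized Taylor remainder. Substituting these reduces a limit
    to an algebraic identity for [t != 0] and the continuity of polynomials. *)
Let y1 t := (a1 t - a1 0 - b1 * t) / t ^+ 2.
Let y2 t := (a2 t - a2 0 - b2 * t) / t ^+ 2.

Let c00 : `|0 : R| <= c.
Proof. by rewrite normr0 ltW. Qed.

Let v2 t : `|t| <= c -> v t ^+ 2 = a1 t ^+ 2 + a2 t ^+ 2.
Proof. by move=> tc; rewrite vE// sqr_sqrtr// addr_ge0 ?sqr_ge0. Qed.

Let A2 : A ^+ 2 = a1 0 ^+ 2 + a2 0 ^+ 2.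
Proof. exact: v2. Qed.

Let a1E t : t != 0 -> a1 t = a1 0 + b1 * t + t * t * y1 t.
Proof. by move=> t0; rewrite /y1; field. Qed.

Let a2E t : t != 0 -> a2 t = a2 0 + b2 * t + t * t * y2 t.
Proof. by move=> t0; rewrite /y2; field. Qed.

Let cvg_v : v @ 0^' --> A.
Proof.
have -> : A = Num.sqrt (a1 0 * a1 0 + a2 0 * a2 0) by rewrite /A vE.
apply: (@cvg_punctured_eq c _ _ (fun t => Num.sqrt
  ((a1 0 + b1 * t + t * t * y1 t) * (a1 0 + b1 * t + t * t * y1 t) +
   (a2 0 + b2 * t + t * t * y2 t) * (a2 0 + b2 * t + t * t * y2 t)))) => //.
  by move=> t t0 tc; rewrite vE// -a1E// -a2E.
apply: cvg_sqrt_punctured.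
rewrite [X in _ --> X](_ : _ =
   (a1 0 + b1 * 0 + 0 * 0 * e1) * (a1 0 + b1 * 0 + 0 * 0 * e1) +
   (a2 0 + b2 * 0 + 0 * 0 * e2) * (a2 0 + b2 * 0 + 0 * 0 * e2)); last by ring.
by cvg_poly.
Qed.

(** Multiplication by the conjugate [v t + A * (1 + p * t)], which tends to [2 * A], replaces the
    square root by [v t ^+ 2]; the terms of degree 0 and 1 cancel by the choice of [A] and [p]. *)
Let cvg_v_taylor : (fun t => (v t - v 0 - (A * p) * t) / t ^+ 2) @ 0^' --> q.
Proof.
have dn : (fun t => v t + A * (1 + p * t)) @ 0^' --> 2 * A.
  have -> : 2 * A = A + A * (1 + p * 0) by ring.
  by cvg_poly.
have An0 : A != 0 by rewrite gt_eqF.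
have [d d0 hd] : exists2 d : R, 0 < d & forall t : R, t != 0 -> `|t| <= d ->
    v t + A * (1 + p * t) != 0.
  apply/near_punctured; move/cvgrPdist_lt: dn => /(_ A v0).
  apply: filterS => t; apply: contraTneq => ->.
  have A0 : 0 < A by [].
  by rewrite subr0 -leNgt ger0_norm; clearbody A; lra.
apply: (@cvg_punctured_eq (Num.min c d) _ _ (fun t =>
  (b1 * b1 + b2 * b2 + 2 * (a1 0 * y1 t + a2 0 * y2 t) - A ^+ 2 * p ^+ 2
   + t * (2 * (b1 * y1 t + b2 * y2 t)) + t * t * (y1 t * y1 t + y2 t * y2 t))
  / (v t + A * (1 + p * t)))).
- by rewrite lt_min c0.
- move=> t t0; rewrite le_min => /andP[tc td].
  have D0 := hd t t0 td.
  apply: (mulIf D0); rewrite divfK//.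
  have -> : (v t - v 0 - A * p * t) / t ^+ 2 * (v t + A * (1 + p * t)) =
    (v t ^+ 2 - A ^+ 2 * (1 + p * t) ^+ 2) / t ^+ 2 by rewrite /A; field.
  rewrite v2// a1E// a2E//.
  have -> : A ^+ 2 * (1 + p * t) ^+ 2 = A ^+ 2 + 2 * (A ^+ 2 * p) * t
    + A ^+ 2 * p ^+ 2 * t ^+ 2 by ring.
  have -> : A ^+ 2 * p = a1 0 * b1 + a2 0 * b2 by rewrite /p; field.
  move: (A ^+ 2 * p ^+ 2) => Ap.
  by rewrite A2; field.
- have -> : q = (b1 * b1 + b2 * b2 + 2 * (a1 0 * e1 + a2 0 * e2) - A ^+ 2 * p ^+ 2
   + 0 * (2 * (b1 * e1 + b2 * e2)) + 0 * 0 * (e1 * e1 + e2 * e2))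
  / (2 * A) by rewrite /q; congr (_ / _); ring.
  apply: cvgM; first by cvg_poly.
  by apply: cvgV => //; rewrite mulf_neq0.
Qed.

Let u1 t := (co1 (Sigma t) - co1 (Sigma 0) - a1 0 * t - b1 / 2 * t ^+ 2) / t ^+ 3.
Let u2 t := (co2 (Sigma t) - co2 (Sigma 0) - a2 0 * t - b2 / 2 * t ^+ 2) / t ^+ 3.
Let w t := (l t - l 0 - v 0 * t - A * p / 2 * t ^+ 2) / t ^+ 3.

Let cvg_u1 : u1 @ 0^' --> e1 / 3.
Proof. exact: (cvg_taylor3 _ _ _ _ _ c0 d1 T1). Qed.

Let cvg_u2 : u2 @ 0^' --> e2 / 3.
Proof. exact: (cvg_taylor3 _ _ _ _ _ c0 d2 T2). Qed.

Let cvg_w : w @ 0^' --> q / 3.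
Proof. exact: (cvg_taylor3 _ _ _ _ _ c0 dl cvg_v_taylor). Qed.

Let x1E t : t != 0 ->
  co1 (Sigma t) - co1 (Sigma 0) = t * (a1 0 + b1 / 2 * t + t * t * u1 t).
Proof. by move=> t0; rewrite /u1; field. Qed.

Let x2E t : t != 0 ->
  co2 (Sigma t) - co2 (Sigma 0) = t * (a2 0 + b2 / 2 * t + t * t * u2 t).
Proof. by move=> t0; rewrite /u2; field. Qed.

Let lE t : t != 0 -> l t = t * (A + A * p / 2 * t + t * t * w t).
Proof. by move=> t0; rewrite /w l0 /A; field. Qed.

Let cvg_l : (fun t => l t / t) @ 0^' --> A.
Proof.
apply: (@cvg_punctured_eq c _ _ (fun t => A + A * p / 2 * t + t * t * w t)) => //.
  by move=> t t0 _; rewrite lE// mulrC mulKf.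
rewrite [X in _ --> X](_ : _ = A + A * p / 2 * 0 + 0 * 0 * (q / 3)); last by ring.
by cvg_poly.
Qed.

(** In the derivative of [hvert] the terms of degree 1 cancel and the coefficient of [t ^+ 2] is
    [- cr]; integration divides it by 3. *)
Let cvg_hvert : (fun t => hvert (Sigma 0) (Sigma t) / t ^+ 3) @ 0^' --> - cr / 3.
Proof.
apply: (@cvg_int_quot _ _ _ c _ 1 c0 (is_derive_hvert _ _ _ _ d1 d2 d3 0)).
- exact: hvertxx.
- by rewrite !subrr !mul0r subrr mulr0.
apply: (@cvg_punctured_eq c _ _ (fun t => 2 *
  ((a2 0 * b1 + b2 / 2 * a1 0 - a1 0 * b2 - b1 / 2 * a2 0) +
   t * (a2 0 * y1 t + b2 / 2 * (b1 + t * y1 t) + u2 t * (a1 0 + t * b1 + t * t * y1 t)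
      - (a1 0 * y2 t + b1 / 2 * (b2 + t * y2 t) + u1 t * (a2 0 + t * b2 + t * t * y2 t))))))
  => //.
  by move=> t t0 tc; rewrite x1E// x2E// (a1E t)// (a2E t)//; field.
rewrite [X in _ --> X](_ : _ = 2 *
  ((a2 0 * b1 + b2 / 2 * a1 0 - a1 0 * b2 - b1 / 2 * a2 0) +
   0 * (a2 0 * e1 + b2 / 2 * (b1 + 0 * e1) + e2 / 3 * (a1 0 + 0 * b1 + 0 * 0 * e1)
      - (a1 0 * e2 + b1 / 2 * (b2 + 0 * e2) + e1 / 3 * (a2 0 + 0 * b2 + 0 * 0 * e2)))));
  last by rewrite /cr; field.
by cvg_poly.
Qed.

Let cvg_pdist2_l : (fun t => (pdist2 (Sigma 0) (Sigma t) - l t ^+ 2) / t ^+ 4) @ 0^'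
  --> - cr ^+ 2 / (12 * A ^+ 2).
Proof.
have An0 : A != 0 by rewrite gt_eqF.
apply: (@cvg_punctured_eq c _ _ (fun t =>
   b1 / 2 * (b1 / 2) + b2 / 2 * (b2 / 2) + 2 * (a1 0 * u1 t + a2 0 * u2 t)
   - A * p / 2 * (A * p / 2) - 2 * A * w t
   + t * (b1 * u1 t + b2 * u2 t - A * p * w t)
   + t * t * (u1 t * u1 t + u2 t * u2 t - w t * w t))) => //.
  move=> t t0 tc; rewrite /pdist2 x1E// x2E// lE//.
  apply: (mulIf (_ : t ^+ 4 != 0)); rewrite ?expf_neq0// divfK ?expf_neq0//.
  apply/eqP; rewrite -subr_eq0; apply/eqP.
  set r1 := u1 t; set r2 := u2 t; set r := w t.
  have Ap : A ^+ 2 * p = a1 0 * b1 + a2 0 * b2 by rewrite /p; field.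
  (* Only the terms of degree 2 and 3 could obstruct the limit; they vanish by [A2] and by the
     definition of [p]. *)
  transitivity (t ^+ 2 * (a1 0 ^+ 2 + a2 0 ^+ 2 - A ^+ 2)
     + t ^+ 3 * (a1 0 * b1 + a2 0 * b2 - A ^+ 2 * p)); first by field.
  by rewrite Ap A2 !subrr !mulr0 addr0.
rewrite [X in _ --> X](_ : _ =
   b1 / 2 * (b1 / 2) + b2 / 2 * (b2 / 2) + 2 * (a1 0 * (e1 / 3) + a2 0 * (e2 / 3))
   - A * p / 2 * (A * p / 2) - 2 * A * (q / 3)
   + 0 * (b1 * (e1 / 3) + b2 * (e2 / 3) - A * p * (q / 3))
   + 0 * 0 * (e1 / 3 * (e1 / 3) + e2 / 3 * (e2 / 3) - q / 3 * (q / 3)));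
  first by cvg_poly.
apply: (mulIf (_ : 12 * A ^+ 2 != 0)); first by rewrite mulf_neq0 ?expf_neq0 ?pnatr_eq0.
rewrite divfK ?mulf_neq0 ?expf_neq0 ?pnatr_eq0//.
(* Lagrange's identity; [e1] and [e2] have cancelled against those in [q]. *)
transitivity (- ((b1 ^+ 2 + b2 ^+ 2) * A ^+ 2 - (a1 0 * b1 + a2 0 * b2) ^+ 2)).
  by rewrite A2 /cr; ring.
by rewrite /q /p; field.
Qed.

Let cvg_pdist2 : (fun t => pdist2 (Sigma 0) (Sigma t) / t ^+ 2) @ 0^' --> A ^+ 2.
Proof.
apply: (@cvg_punctured_eq c _ _ (fun t =>
   (pdist2 (Sigma 0) (Sigma t) - l t ^+ 2) / t ^+ 4 * (t * t) + l t / t * (l t / t))) => //.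
  by move=> t t0 _; field.
rewrite [X in _ --> X](_ : _ = - cr ^+ 2 / (12 * A ^+ 2) * (0 * 0) + A * A); last by ring.
by cvg_poly.
Qed.

Let cvg_N : (fun t => N t / `|t|) @ 0^' --> A.
Proof.
apply: (@cvg_punctured_eq c _ _ (fun t => Num.sqrt (Num.sqrt
   (pdist2 (Sigma 0) (Sigma t) / t ^+ 2 * (pdist2 (Sigma 0) (Sigma t) / t ^+ 2) +
    (t * t) * (hvert (Sigma 0) (Sigma t) / t ^+ 3 *
               (hvert (Sigma 0) (Sigma t) / t ^+ 3)))))) => //.
  move=> t t0 _; rewrite -[LHS]sqrt_sqrt_exp4 ?divr_ge0 ?hdist_ge0//.
  have -> : (N t / `|t|) ^+ 4 = N t ^+ 4 / t ^+ 4.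
    rewrite expr_div_n; congr (_ / _).
    by rewrite -normrX ger0_norm// (exprM t 2 2) sqr_ge0.
  by congr (Num.sqrt (Num.sqrt _)); rewrite /N hdist4; field.
rewrite -[X in _ --> X]sqrt_sqrt_exp4 ?(ltW v0)//.
apply/cvg_sqrt_punctured/cvg_sqrt_punctured.
rewrite [X in _ --> X](_ : _ = A ^+ 2 * A ^+ 2 + (0 * 0) * (- cr / 3 * (- cr / 3)));
  last by ring.
by cvg_poly.
Qed.

Let cvg_norml : (fun t => `|l t| / `|t|) @ 0^' --> A.
Proof.
apply: (@cvg_punctured_eq c _ _ (fun t => `|l t / t|)) => //.
  by move=> t _ _; rewrite normrM normfV.
by rewrite -[X in _ --> X]ger0_norm ?(ltW v0)//; exact: cvg_norm.
Qed.

(** The difference is multiplied by [(|l| + N) * (l ^+ 2 + N ^+ 2)] to reach [l ^+ 4 - N ^+ 4].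
    Divided by [t ^+ 6], this tends to [cr ^+ 2 / 6 - cr ^+ 2 / 9 = cr ^+ 2 / 18], from the
    horizontal and vertical parts; the denominator tends to [4 * A ^+ 6], whence 72. *)
Let cvg_arc_chord : (fun t => (`|l t| - N t) / N t ^+ 3) @ 0^'
  --> (cr / A ^+ 3) ^+ 2 / 72.
Proof.
have An0 : A != 0 by rewrite gt_eqF.
have [d d0 hd] : exists2 d : R, 0 < d & forall t : R, t != 0 -> `|t| <= d ->
    N t / `|t| != 0.
  apply/near_punctured; move/cvgrPdist_lt: cvg_N => /(_ A v0).
  by apply: filterS => t; apply: contraTneq => ->; rewrite subr0 -leNgt ler_norm.
apply: (@cvg_punctured_eq d _ _ (fun t =>
  - ((pdist2 (Sigma 0) (Sigma t) - l t ^+ 2) / t ^+ 4 *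
     (pdist2 (Sigma 0) (Sigma t) / t ^+ 2 + l t / t * (l t / t))
     + hvert (Sigma 0) (Sigma t) / t ^+ 3 * (hvert (Sigma 0) (Sigma t) / t ^+ 3))
  / ((`|l t| / `|t| + N t / `|t|) *
     (`|l t| / `|t| * (`|l t| / `|t|) + N t / `|t| * (N t / `|t|)) *
     (N t / `|t| * (N t / `|t| * (N t / `|t|)))))) => //.
  move=> t t0 td; have nt0 : `|t| != 0 by rewrite normr_eq0.
  have := hd t t0 td; rewrite mulf_eq0 invr_eq0 negb_or => /andP[N0 _].
  have N0' : 0 < N t by rewrite lt0r N0 hdist_ge0.
  have s0 : `|l t| + N t != 0 by rewrite gt_eqF// ltr_wpDl.
  have s1 : `|l t| ^+ 2 + N t ^+ 2 != 0.
    by rewrite gt_eqF// ltr_wpDl ?sqr_ge0// exprn_gt0.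
  have numE : (pdist2 (Sigma 0) (Sigma t) - l t ^+ 2) / t ^+ 4 *
     (pdist2 (Sigma 0) (Sigma t) / t ^+ 2 + l t / t * (l t / t))
     + hvert (Sigma 0) (Sigma t) / t ^+ 3 * (hvert (Sigma 0) (Sigma t) / t ^+ 3)
     = (N t ^+ 4 - `|l t| ^+ 4) / `|t| ^+ 6.
    rewrite /N hdist4 (exprM `|l t| 2 2) (exprM `|t| 2 3) !real_normK ?num_real//.
    by field.
  by rewrite numE; field; rewrite s0 s1 N0 nt0.
have AA : A + A != 0 by rewrite -mulr2n mulrn_eq0.
have AAA : A * A + A * A != 0 by rewrite -mulr2n mulrn_eq0 mulf_neq0.
rewrite [X in _ --> X](_ : _ =
  - (- cr ^+ 2 / (12 * A ^+ 2) * (A ^+ 2 + A * A) + - cr / 3 * (- cr / 3))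
  / ((A + A) * (A * A + A * A) * (A * (A * A)))); last by field; rewrite An0 AAA.
apply: cvgM; first by cvg_poly.
by apply: cvgV; [rewrite !mulf_neq0|cvg_poly].
Qed.

Lemma arc_chord_expansion (e : R) : 0 < e ->
  exists2 d : R, 0 < d & forall t : R, `|t| <= d ->
    `| `|l t| - hdist (Sigma 0) (Sigma t)
       - ((a1 0 * b2 - a2 0 * b1) / v 0 ^+ 3) ^+ 2 / 72 * hdist (Sigma 0) (Sigma t) ^+ 3 |
    <= e * hdist (Sigma 0) (Sigma t) ^+ 3.
Proof.
rewrite -/cr -/A => e0; have An0 : A != 0 by rewrite gt_eqF.
have near1 : \forall t \near 0^', N t != 0.
  move/cvgrPdist_lt: cvg_N => /(_ A v0); apply: filterS => t.
  by apply: contraTneq => ->; rewrite mul0r subr0 -leNgt ler_norm.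
have := cvg_arc_chord => /cvgrPdist_le /(_ e e0) near2.
have [d d0 hd] := (near_punctured _).1 (filterI near1 near2).
exists d => // t td; rewrite -/(N t); have [->|t0] := eqVneq t 0.
  by rewrite l0 /N hdistxx expr0n /= !mulr0 !subr0 !normr0.
have [N0 le_e] := hd t t0 td.
have N3 : 0 < N t ^+ 3 by rewrite exprn_gt0// lt0r N0 hdist_ge0.
set k := _ / 72 in le_e *.
have -> : `|l t| - N t - k * N t ^+ 3 = - ((k - (`|l t| - N t) / N t ^+ 3) * N t ^+ 3).
  by rewrite mulrBl divfK ?gt_eqF// opprB.
by rewrite normrN normrM (ger0_norm (ltW N3)) ler_pM2r.
Qed.

End expansion.

(** * Local consequences of smoothness and of the embedding *)

Section local_structure.
Context {R : realType}.
Local Notation H := (R * R * R)%type.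

Lemma near_nbhs0 (P : R -> Prop) : (\forall x \near (0 : R), P x) ->
  exists2 d : R, 0 < d & forall x : R, `|x| <= d -> P x.
Proof.
move=> [d /= d0 hd]; exists (d / 2); first exact: divr_gt0.
move=> x xd; apply: hd => /=.
by rewrite sub0r normrN (le_lt_trans xd)// ltr_pdivrMr// mulr_natr mulr2n ltrDl.
Qed.

(** The bounds come from continuity of the first two derivatives at 0; the expansion integrates the
    difference quotient of the second derivative at 0. *)
Lemma class_C3_local (I : set R) (f : R -> R) : open I -> I 0 -> class_C 3 I f ->
  exists c B M : R, [/\ 0 < c, 0 <= M,
    forall t, `|t| <= c -> [/\ I t, is_derive t 1 f (derive1 f t),
      {for t, continuous (derive1 f)} & `|derive1 f t| <= B],
    forall s t, `|s| <= c -> `|t| <= c -> `|derive1 f s - derive1 f t| <= M * `|s - t| &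
    (fun t => (derive1 f t - derive1 f 0 - derive1n 2 f 0 * t) / t ^+ 2) @ 0^'
      --> derive1n 3 f 0 / 2].
Proof.
move=> oI I0 Cf.
have D n t : I t -> (n < 3)%N ->
    is_derive t 1 (derive1n n f) (derive1n n.+1 f t).
  move=> It n3; have [/(_ n n3) df _] := Cf t It.
  by rewrite derive1nS derive1E; exact: derivableP.
have cont n t : I t -> (n < 3)%N -> {for t, continuous (derive1n n f)}.
  move=> It n3; have [df _] := D n t It n3.
  by apply/differentiable_continuous/derivable1_diffP.
have [c1 c1_gt0 Ic] : exists2 d : R, 0 < d & forall x, `|x| <= d -> I x.
  by apply: near_nbhs0; exact: open_nbhs_nbhs.
have bnd n : (n < 3)%N -> exists2 d : R, 0 < d &
    forall x, `|x| <= d -> `|derive1n n f x| <= `|derive1n n f 0| + 1.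
  move=> n3; apply: near_nbhs0.
  have /cvgrPdist_le /(_ 1 ltr01) := cont n 0 I0 n3.
  apply: filterS => x; rewrite distrC => xb.
  rewrite -[X in `|X|](subrK (derive1n n f 0)) (le_trans (ler_normD _ _))//.
  by rewrite addrC lerD2l.
have [c2 c2_gt0 bnd1] := bnd 1%N isT.
have [c3 c3_gt0 bnd2] := bnd 2%N isT.
pose c := Num.min c1 (Num.min c2 c3).
have c0 : 0 < c by rewrite !lt_min c1_gt0 c2_gt0.
have cP t : `|t| <= c -> [/\ I t, `|derive1n 1 f t| <= `|derive1n 1 f 0| + 1 &
    `|derive1n 2 f t| <= `|derive1n 2 f 0| + 1].
  by rewrite !le_min => /and3P[/Ic ? /bnd1 ? /bnd2].
have d2 (x : R) : `|x| <= c -> is_derive x 1 (derive1 f) (derive1n 2 f x).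
  by move=> /cP[Ix _ _]; exact: (D 1%N).
exists c, (`|derive1n 1 f 0| + 1), (`|derive1n 2 f 0| + 1); split => //.
- move=> t /cP[It h1 h2]; split=> //; first exact: (D 0%N).
  exact: (cont 1%N).
- move=> s t sc tc; have [x [_ _ xc ->]] := mvt_sym _ _ _ _ _ d2 tc sc.
  by rewrite normrM ler_wpM2r//; have [] := cP x xc.
- apply: (@cvg_int_quot _ (fun t => derive1 f t - derive1 f 0 - derive1n 2 f 0 * t)
    (fun t => derive1n 2 f t - derive1n 2 f 0) c _ 0 c0) => //.
  + move=> x xc; have dx := d2 x xc.
    have -> : (fun t => derive1 f t - derive1 f 0 - derive1n 2 f 0 * t) =
      derive1 f - cst (derive1 f 0) - derive1n 2 f 0 *: (@id R).
      by apply/funext => u; rewrite !fctE.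
    apply: is_derive_eq (is_deriveB (is_deriveB dx (is_derive_cst _ _ _))
      (is_deriveZ _ (is_derive_id _ _))) _.
    by rewrite subr0 /GRing.scale /= mulr1.
  + by rewrite mulr0 !subrr.
  + by rewrite subrr.
  + by apply: cvg_diff_quot0; exact: (D 2%N).
Qed.

Lemma ex_primitive (v : R -> R) (c : R) : 0 < c ->
  (forall t, `|t| <= c -> {for t, continuous v}) ->
  exists l : R -> R, l 0 = 0 /\
    forall t : R, `|t| <= c / 2 -> is_derive t 1 l (v t).
Proof.
move=> c0 vc.
(* Integration starts at [- c], so that every [t] of size at most [c / 2], of either sign, is
   interior to the domain. *)
pose F x := (\int[lebesgue_measure]_(t in `[- c, x]) v t)%R.
exists (fun x => F x - F 0); split; first by rewrite subrr.
move=> t tc.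
have /andP[t1 t2] : - c < t < c.
  by move: tc; rewrite ler_norml; lra.
have intv : lebesgue_measure.-integrable `[- c, c] (EFin \o v).
  apply: continuous_compact_integrable; first exact: segment_compact.
  apply: continuous_in_subspaceT => x; rewrite inE /= in_itv /= => xc.
  by apply: vc; rewrite ler_norml.
have tc' : `|t| <= c by rewrite ler_norml !ltW.
have [dF F't] := continuous_FTC1_closed t2 intv t1 (vc t tc').
have dF' : is_derive t 1 F (v t) by rewrite -F't derive1E; exact: derivableP.
have -> : (fun x => F x - F 0) = F - cst (F 0) by apply/funext => x; rewrite !fctE.
by apply: is_derive_eq; rewrite subr0.
Qed.

(** Horizontal increments are at most [hdist x y]. The increment of [co3] is recovered from [hvert]
    and the horizontal increments, with a factor depending on [x]; distance at most 1 lets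
    [hdist x y] dominate its square. *)
Lemma hdist_small_ball (x : H) (d : R) : 0 < d ->
  exists2 eta : R, 0 < eta & forall y, hdist x y <= eta -> ball x d y.
Proof.
move=> d0.
pose C := 2 + 2 * `|co1 x| + 2 * `|co2 x|.
have C0 : 0 < C by rewrite ltr_pwDl// ?ltr_pwDl// mulr_ge0.
exists (Num.min 1 (d / (2 * C))).
  by rewrite lt_min ltr01 divr_gt0// mulr_gt0.
move=> y; rewrite le_min => /andP[N1 Nd].
have N0 := hdist_ge0 x y.
have NC : hdist x y * C < d.
  move: Nd; rewrite ler_pdivlMr ?mulr_gt0//; nra.
have sq (a b : R) : 0 <= b -> a ^+ 2 <= b ^+ 2 -> `|a| <= b.
  by move=> b0; rewrite -(real_normK (num_real a)) ler_pXn2r ?nnegrE.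
have h1 : `|co1 y - co1 x| <= hdist x y.
  apply: sq => //; apply: le_trans (pdist2_le_hdist x y).
  by rewrite lerDl sqr_ge0.
have h2 : `|co2 y - co2 x| <= hdist x y.
  apply: sq => //; apply: le_trans (pdist2_le_hdist x y).
  by rewrite lerDr sqr_ge0.
have h3 : `|hvert x y| <= hdist x y.
  apply: sq => //; apply: (@le_trans _ _ (hdist x y ^+ 4)).
    by rewrite hdist4 lerDr sqr_ge0.
  by rewrite ler_wiXn2l.
have h4 : `|co3 y - co3 x| <= hdist x y * (C - 1).
  have -> : co3 y - co3 x = hvert x y +
     (2 * co2 x * (co1 y - co1 x) - 2 * co1 x * (co2 y - co2 x)).
    by rewrite /hvert; ring.
  apply: le_trans (ler_normD _ _) _.
  have := ler_normB (2 * co2 x * (co1 y - co1 x)) (2 * co1 x * (co2 y - co2 x)).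
  rewrite !normrM normr_nat /C.
  have := normr_ge0 (co1 x); have := normr_ge0 (co2 x); nra.
have Nlt : hdist x y < d.
  apply: le_lt_trans NC; rewrite /C.
  by have := normr_ge0 (co1 x); have := normr_ge0 (co2 x); nra.
split; last first.
  rewrite /ball /= distrC; apply: le_lt_trans h4 _; apply: le_lt_trans NC; nra.
by split; rewrite /ball /= distrC; [apply: le_lt_trans h1 _|apply: le_lt_trans h2 _].
Qed.

(** Continuity of the inverse parametrization keeps the curve from returning near [Sigma 0] at
    distant parameters; the embedding enters here. *)
Lemma homeo_small_param (I : set R) (Sigma : R -> H) (d : R) :
  I 0 -> homeo_onto_image I Sigma -> 0 < d ->
  exists2 eta : R, 0 < eta &
    forall t, I t -> hdist (Sigma 0) (Sigma t) <= eta -> `|t| <= d.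
Proof.
move=> I0 [_ [g [gK cg]]] d0.
have S0 : (Sigma @` I) (Sigma 0) by exists 0.
have gS : g y @[y --> within (Sigma @` I) (nbhs (Sigma 0))] --> g (Sigma 0).
  exact: ((subspace_continuousP _ _).1 cg _ S0).
move/cvgrPdist_le: gS => /(_ d d0).
rewrite near_withinE gK// => /nbhs_ballP[/= e e0 be].
have [eta eta0 heta] := hdist_small_ball (Sigma 0) e e0.
exists eta => // t It /heta /be -/(_ (ex_intro2 _ _ t It erefl)).
by rewrite gK// sub0r normrN.
Qed.

End local_structure.

(** * Reparametrization by arc length *)

Section arclength.
Context {R : realType}.
Local Notation H := (R * R * R)%type.
Context (Sigma : R -> H) (a1 a2 v l : R -> R) (c : R) (c0 : 0 < c).
Context (d1 : forall t : R, `|t| <= c -> is_derive t 1 (co1 \o Sigma) (a1 t)).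
Context (d2 : forall t : R, `|t| <= c -> is_derive t 1 (co2 \o Sigma) (a2 t)).
Context (d3 : forall t : R, `|t| <= c -> is_derive t 1 (co3 \o Sigma)
  (2 * co2 (Sigma t) * a1 t - 2 * co1 (Sigma t) * a2 t)).
Context (dl : forall t : R, `|t| <= c -> is_derive t 1 l (v t)).
Context (v2 : forall t : R, `|t| <= c -> v t ^+ 2 = a1 t ^+ 2 + a2 t ^+ 2).
Context (B M : R) (M0 : 0 <= M).
Context (B1 : forall t, `|t| <= c -> `|a1 t| <= B).
Context (B2 : forall t, `|t| <= c -> `|a2 t| <= B).
Context (M1 : forall s t, `|s| <= c -> `|t| <= c -> `|a1 s - a1 t| <= M * `|s - t|).
Context (M2 : forall s t, `|s| <= c -> `|t| <= c -> `|a2 s - a2 t| <= M * `|s - t|).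
Context (m : R) (m0 : 0 < m) (mv : forall t, `|t| <= c -> m <= v t) (l0 : l 0 = 0).

Lemma arclength_lower (s t : R) : `|s| <= c -> `|t| <= c ->
  m * `|s - t| <= `|l s - l t|.
Proof.
move=> sc tc; have [x [_ _ xc ->]] := mvt_sym _ _ _ _ _ dl tc sc.
by rewrite normrM ler_wpM2r// (le_trans (mv _ xc))// ler_norm.
Qed.

Lemma arclength_onto (s : R) : `|s| <= m * c -> exists2 t, `|t| <= c & l t = s.
Proof.
move=> sc; have c00 : `|0 : R| <= c by rewrite normr0 ltW.
have cc : `|c| <= c by rewrite ger0_norm// ltW.
have Ncc : `|- c| <= c by rewrite normrN.
have lc : m * c <= l c.
  have [x [_ _ xc E]] := mvt_sym _ _ _ _ _ dl c00 cc.
  by move: E; rewrite l0 !subr0 => ->; rewrite ler_wpM2r ?mv// ltW.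
have lNc : l (- c) <= - (m * c).
  have [x [_ _ xc E]] := mvt_sym _ _ _ _ _ dl c00 Ncc.
  by move: E; rewrite l0 !subr0 mulrN => ->; rewrite lerN2 ler_wpM2r ?mv// ltW.
have [|||t tc E] := @IVT R l (- c) c s.
- by rewrite ge0_cp// ltW.
- apply: derivable_within_continuous => x; rewrite in_itv /= -ler_norml => xc.
  by have [] := dl x xc.
- move: sc; rewrite ler_norml => /andP[s1 s2].
  by rewrite ge_min le_max (le_trans lNc s1) (le_trans s2 lc) orbT.
- by exists t => //; move: tc; rewrite in_itv /= -ler_norml.
Qed.

Lemma spherical1_arclength : exists2 rho, 0 < rho &
  (forall w, 0 <= w <= rho ->
     spherical1 (Sigma @` [set t | `|t| <= c /\ `|l t| <= w]) = (2 * w)%:E) /\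
  (forall t, `|t| <= c -> `|l t| <= rho -> hdist (Sigma 0) (Sigma t) <= 2 * `|l t|).
Proof.
have c00 : `|0 : R| <= c by rewrite normr0 ltW.
have B0 : 0 <= B by apply: le_trans (B1 _ c00).
(* The division by [m ^+ 3] converts [|s - t|] into arc length through [arclength_lower]. *)
pose K := 8 * B * M / m ^+ 3.
have K0 : 0 <= K by rewrite !mulr_ge0// invr_ge0 exprn_ge0// ltW.
have K1 : 0 < 4 * K + 1 by rewrite ltr_wpDl// mulr_ge0.
(* The first bound makes [l] reach every value up to [rho]; the second gives [4 * K * rho <= 1]. *)
pose rho := Num.min (m * c) (4 * K + 1)^-1.
have rho0 : 0 < rho by rewrite lt_min mulr_gt0//= invr_gt0.
have rhomc : rho <= m * c by rewrite ge_min lexx.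
have Krho : 4 * K * rho <= 1.
  have : rho <= (4 * K + 1)^-1 by rewrite ge_min lexx orbT.
  by rewrite -[X in _ <= X]mulr1 ler_pdivlMl//; nra.
have cube s t : `|s| <= c -> `|t| <= c ->
    8 * B * M * `|s - t| ^+ 3 <= K * `|l s - l t| ^+ 3.
  move=> sc tc.
  have -> : K * `|l s - l t| ^+ 3 = 8 * B * M * (`|l s - l t| ^+ 3 / m ^+ 3).
    by rewrite /K; ring.
  rewrite ler_wpM2l ?mulr_ge0//.
  rewrite ler_pdivlMr ?exprn_gt0// mulrC -exprMn.
  by rewrite ler_pXn2r ?nnegrE ?mulr_ge0 ?(ltW m0) ?arclength_lower.
have est s t : `|s| <= c -> `|t| <= c ->
   `|pdist2 (Sigma s) (Sigma t) - (l s - l t) ^+ 2| <= K * `|l s - l t| ^+ 3 /\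
   `|hvert (Sigma s) (Sigma t)| <= K * `|l s - l t| ^+ 3.
  move=> sc tc; split; apply: le_trans (cube _ _ sc tc).
    exact: (pdist2_arc _ _ _ _ _ _ d1 d2 dl v2).
  exact: (hvert_arc _ _ _ _ d1 d2 d3).
exists rho => //; split.
- move=> w /andP[w0 wr].
  (* An inverse of [l]; the default value 0 does not occur for [|s| <= rho]. *)
  pose tau s := xget 0 [set t | `|t| <= c /\ l t = s].
  have tauP s : `|s| <= rho -> `|tau s| <= c /\ l (tau s) = s.
    move=> sr; have [t tc E] := arclength_onto s (le_trans sr rhomc).
    exact: (xgetPex 0 (ex_intro [set t | `|t| <= c /\ l t = s] t (conj tc E))).
  have -> : Sigma @` [set t | `|t| <= c /\ `|l t| <= w] =
            (Sigma \o tau) @` `[- w, w].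
    apply/seteqP; split=> [_ [t [tc ltw] <-]|_ [s sw <-]].
      exists (l t); first by rewrite /= in_itv /= -ler_norml.
      have [tc' E] := tauP (l t) (le_trans ltw wr).
      congr Sigma; apply/eqP; rewrite -subr_eq0 -normr_le0.
      by have := arclength_lower _ _ tc' tc; rewrite E subrr normr0 pmulr_rle0.
    have {}sw : `|s| <= w by move: sw; rewrite /= in_itv /= -ler_norml.
    have [tc E] := tauP s (le_trans sw wr).
    by exists (tau s) => //=; rewrite E.
  have -> : 2 * w = w - - w by ring.
  apply: (spherical1_eq_length _ K rho) => //; last 2 first.
  + by rewrite lerN2.
  + lra.
  move=> s t /tauP[sc Es] /tauP[tc Et].
  by have := est _ _ sc tc; rewrite Es Et.
- move=> t tc ltr; apply: hdist_le; first by rewrite mulr_ge0.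
  have [] := est 0 t c00 tc; rewrite l0 !sub0r sqrrN normrN.
  rewrite -(real_normK (num_real (l t))).
  have := normr_ge0 (l t); move: (`|l t|) ltr => D Dr D0.
  move=> /ler_normlP[_ h1] h2.
  have KD : K * D <= 1 by nra.
  have KD3 : K * D ^+ 3 <= D ^+ 2 by rewrite exprS mulrA ler_piMl// sqr_ge0.
  have h3 : pdist2 (Sigma 0) (Sigma t) ^+ 2 <= (2 * D ^+ 2) ^+ 2.
    by rewrite ler_pXn2r ?nnegrE ?pdist2_ge0 ?mulr_ge0 ?sqr_ge0//; lra.
  have h4 : hvert (Sigma 0) (Sigma t) ^+ 2 <= (D ^+ 2) ^+ 2.
    rewrite -(real_normK (num_real (hvert _ _))).
    by rewrite ler_pXn2r ?nnegrE ?sqr_ge0//; lra.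
  apply: le_trans (lerD h3 h4) _.
  have -> : (2 * D ^+ 2) ^+ 2 + (D ^+ 2) ^+ 2 = 5 * D ^+ 4 by ring.
  have -> : (2 * D) ^+ 4 = 16 * D ^+ 4 by ring.
  by rewrite ler_wpM2r ?exprn_ge0// ler_nat.
Qed.

End arclength.

(** * The ball squeezed between two arcs *)

Section sandwich.
Context {R : realType}.
Local Notation H := (R * R * R)%type.

(** The part of the curve in the ball contains the arc [|l t| <= r + (kappa - e) * r ^+ 3] and is
    contained in the arc with [kappa + e]; [hmeas] measures both. *)
Lemma spherical1_ball_sandwich (I : set R) (Sigma : R -> H) (l : R -> R)
    (c m rho kappa : R) :
  0 < c -> 0 < m -> 0 < rho -> 0 <= kappa ->
  (forall t, `|t| <= c -> I t) ->
  (forall t, `|t| <= c -> m * `|t| <= `|l t|) ->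
  (forall w, 0 <= w <= rho ->
     spherical1 (Sigma @` [set t | `|t| <= c /\ `|l t| <= w]) = (2 * w)%:E) ->
  (forall t, `|t| <= c -> `|l t| <= rho -> hdist (Sigma 0) (Sigma t) <= 2 * `|l t|) ->
  (forall e : R, 0 < e -> exists2 d : R, 0 < d & forall t, `|t| <= d ->
     `| `|l t| - hdist (Sigma 0) (Sigma t)
        - kappa * hdist (Sigma 0) (Sigma t) ^+ 3 |
     <= e * hdist (Sigma 0) (Sigma t) ^+ 3) ->
  (forall d : R, 0 < d -> exists2 eta : R, 0 < eta &
     forall t, I t -> hdist (Sigma 0) (Sigma t) <= eta -> `|t| <= d) ->
  forall e : R, 0 < e -> exists2 r0 : R, 0 < r0 & forall r : R, 0 < r <= r0 ->
    ((2 * (r + (kappa - e) * r ^+ 3))%R%:E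
      <= spherical1 (hball (Sigma 0%R) r `&` Sigma @` I)
      <= (2 * (r + (kappa + e) * r ^+ 3))%R%:E)%E.
Proof.
move=> c0 m0 rho0 k0 cI lm hmeas hN hexp hemb e e0.
have [d1 d10 hd1] := hexp e e0.
pose d := Num.min c d1; have d0 : 0 < d by rewrite lt_min c0.
have [eta eta0 heta] := hemb d d0.
have C0 : 0 < 96 * (kappa + e) + 1 by rewrite ltr_wpDl// mulr_ge0 ?addr_ge0 ?(ltW e0).
(* In order: points in the ball have small parameters; arcs of half-length at most [2 * r] fall
   under [hmeas]; [|l t| <= 2 * r] forces [|t| <= d]; the cubic terms are small against [r]. *)
pose r0 := Num.min (Num.min eta (rho / 2)) (Num.min (m * d / 2) (96 * (kappa + e) + 1)^-1).
have r00 : 0 < r0 by rewrite !lt_min eta0 !divr_gt0 ?mulr_gt0 ?invr_gt0.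
exists r0 => // r /andP[rp]; rewrite !le_min => /andP[/andP[r1 r2] /andP[r3 r4]].
have ke0 : 0 <= kappa + e by rewrite addr_ge0// ltW.
have kr : 96 * (kappa + e) * r <= 1.
  by move: r4; rewrite -[X in _ <= X]mulr1 ler_pdivlMl//; nra.
have r_le1 : r <= 1.
  by apply: le_trans r4 _; rewrite invf_le1// lerDr mulr_ge0.
have kr2 : 96 * (kappa + e) * r ^+ 2 <= 1.
  by apply: le_trans kr; rewrite expr2 mulrA ler_piMr// !mulr_ge0// ltW.
have er2 : 96 * (e * r ^+ 2) <= 1.
  apply: le_trans kr2; rewrite -mulrA ler_pM2l// ler_wpM2r ?sqr_ge0//; lra.
have kr3 : (kappa + e) * r ^+ 3 <= r.
  have -> : (kappa + e) * r ^+ 3 = ((kappa + e) * r ^+ 2) * r by ring.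
  by rewrite ler_piMl ?(ltW rp)//; lra.
have ker3 : 0 <= kappa * r ^+ 3 by rewrite mulr_ge0// exprn_ge0// ltW.
have er30 : 0 <= e * r ^+ 3 by rewrite mulr_ge0 ?exprn_ge0 ?(ltW e0)// ltW.
have er3 : e * r ^+ 3 <= r by move: kr3; rewrite mulrDl; lra.
have dc (t : R) : `|t| <= d -> `|t| <= c /\ `|t| <= d1 by rewrite le_min => /andP.
apply/andP; split.
- rewrite -hmeas; last by move: kr3 er3; rewrite mulrBl mulrDl; lra.
  apply: spherical1_le => _ [t [tc ltr] <-]; split; last first.
    by exists t => //; exact: cI.
  have ltr2 : `|l t| <= 2 * r by move: ltr kr3; rewrite mulrBl mulrDl; lra.
  have Nt := hN t tc; have {}Nt : hdist (Sigma 0) (Sigma t) <= 4 * r.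
    by apply: le_trans (Nt _) _; lra.
  have td : `|t| <= d.
    by rewrite -(ler_pM2l m0); have := lm t tc; lra.
  have [_ /hd1] := dc _ td; move: Nt; rewrite /hball /=.
  have := hdist_ge0 (Sigma 0) (Sigma t); move: (hdist _ _) => N N0 N4r.
  move=> /ler_normlP[h _]; rewrite leNgt; apply/negP => rN.
  have {}h : N + (kappa - e) * N ^+ 3 <= r + (kappa - e) * r ^+ 3.
    by apply: le_trans ltr; rewrite mulrBl; lra.
  have N2 : N ^+ 2 <= 16 * r ^+ 2 by nra.
  have NrN : N * r <= N ^+ 2 by rewrite expr2 ler_wpM2l// ltW.
  have rrN : r ^+ 2 <= N ^+ 2 by rewrite ler_pXn2r ?nnegrE ?(ltW rp)// ltW.
  (* Strict monotonicity of [N + (kappa - e) * N ^+ 3], where [kappa - e] may be negative. As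
     [N <= 4 * r], the sum [S] is at most [48 * r ^+ 2], so 96 gives [e * S <= 1 / 2]. *)
  have : 0 < (N - r) * (1 + (kappa - e) * (N ^+ 2 + N * r + r ^+ 2)).
    rewrite mulr_gt0 ?subr_gt0//.
    set S := N ^+ 2 + _ + _; have S0 : 0 <= S by rewrite !addr_ge0 ?sqr_ge0 ?mulr_ge0// ltW.
    have S48 : S <= 48 * r ^+ 2 by rewrite /S; lra.
    have kS : 0 <= kappa * S by rewrite mulr_ge0.
    have eS : e * S <= e * (3 * N ^+ 2) by rewrite ler_pM2l// /S; lra.
    have : e * S <= e * (48 * r ^+ 2) by rewrite ler_pM2l.
    by rewrite mulrBl; lra.
  have -> : (N - r) * (1 + (kappa - e) * (N ^+ 2 + N * r + r ^+ 2)) =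
    (N + (kappa - e) * N ^+ 3) - (r + (kappa - e) * r ^+ 3) by ring.
  lra.
- rewrite -hmeas; last by move: kr3; rewrite !mulrDl; lra.
  apply: spherical1_le => y [yr [t It yE]]; move: yr; rewrite -yE /hball /= => Nr.
  have /dc[tc td1] := heta t It (le_trans Nr r1).
  exists t => //; split=> //.
  have := hd1 t td1; move: Nr.
  have := hdist_ge0 (Sigma 0) (Sigma t); move: (hdist _ _) => N N0 Nr.
  move=> /ler_normlP[_ h].
  have N3 : N ^+ 3 <= r ^+ 3 by rewrite ler_pXn2r ?nnegrE ?(ltW rp).
  have : (kappa + e) * N ^+ 3 <= (kappa + e) * r ^+ 3.
    by rewrite ler_wpM2l// addr_ge0// ltW.
  rewrite !mulrDl; lra.
Qed.

End sandwich.

(** * Assembly on a common neighbourhood of 0 *)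

Section main_estimate.
Context {R : realType}.
Local Notation H := (R * R * R)%type.

Lemma spherical1_ball_expansion (I : set R) (Sigma : R -> H) :
  open I -> I 0 -> embedded_curve 3 I Sigma -> horizontal I Sigma ->
  forall e : R, 0 < e -> exists2 r0 : R, 0 < r0 & forall r : R, 0 < r <= r0 ->
    ((2 * (r + (planar_curvature (hproj \o Sigma) 0 ^+ 2 / 72 - e) * r ^+ 3))%R%:E
      <= spherical1 (hball (Sigma 0%R) r `&` Sigma @` I)
      <= (2 * (r + (planar_curvature (hproj \o Sigma) 0 ^+ 2 / 72 + e) * r ^+ 3))%R%:E)%E.
Proof.
move=> oI I0 [[C1 C2 C3] reg homeo] hor.
pose x1 := co1 \o Sigma; pose x2 := co2 \o Sigma; pose x3 := co3 \o Sigma.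
pose a1 := derive1 x1; pose a2 := derive1 x2.
have [c1 [B1 [M1 [c1_gt0 M1_ge0 loc1 lip1 T1]]]] := class_C3_local I x1 oI I0 C1.
have [c2 [B2 [M2 [c2_gt0 M2_ge0 loc2 lip2 T2]]]] := class_C3_local I x2 oI I0 C2.
pose v t := Num.sqrt (a1 t ^+ 2 + a2 t ^+ 2).
have d3 (t : R) : I t -> is_derive t 1 x3
    (2 * co2 (Sigma t) * a1 t - 2 * co1 (Sigma t) * a2 t).
  move=> It; have [/(_ 0%N isT) dx _] := C3 t It.
  have -> : 2 * co2 (Sigma t) * a1 t - 2 * co1 (Sigma t) * a2 t = derive1 x3 t.
    by have := hor t It; rewrite /a1 /a2 /x1 /x2 /x3; lra.
  by rewrite derive1E; exact: derivableP.
(* If the planar velocity vanished, horizontality would make the third component vanish too, against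
   regularity. *)
have v0 : 0 < v 0.
  rewrite sqrtr_gt0 lt0r addr_ge0 ?sqr_ge0// andbT; apply/eqP => /eqP.
  rewrite paddr_eq0 ?sqr_ge0// !expf_eq0 /= => /andP[/eqP a10 /eqP a20].
  apply: (reg 0 I0); have [_ E3] := d3 0 I0.
  by rewrite [derive1 (co3 \o Sigma) 0]derive1E E3 -/a1 -/a2 a10 a20 !mulr0 subrr.
pose c12 := Num.min c1 c2; have c12_gt0 : 0 < c12 by rewrite lt_min c1_gt0.
have in12 (t : R) : `|t| <= c12 -> `|t| <= c1 /\ `|t| <= c2.
  by rewrite le_min => /andP.
have vc (t : R) : `|t| <= c12 -> {for t, continuous v}.
  move=> /in12[/loc1[_ _ k1 _] /loc2[_ _ k2 _]].
  have sq : (fun u => a1 u * a1 u + a2 u * a2 u) @ t --> a1 t * a1 t + a2 t * a2 t.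
    by apply: cvgD; apply: cvgM.
  exact: (cvg_comp _ _ sq (@sqrt_continuous _ _)).
have [l [l0 dl]] := ex_primitive v c12 c12_gt0 vc.
(* Half the initial speed serves as the lower bound [m] for the speed. *)
have [c3 c3_gt0 vlow] : exists2 d : R, 0 < d &
    forall t : R, `|t| <= d -> v 0 / 2 <= v t.
  apply: near_nbhs0; have v02 : 0 < v 0 / 2 by rewrite divr_gt0.
  have /cvgrPdist_le /(_ _ v02) : v @ (0 : R) --> v 0.
    by apply: vc; rewrite normr0 ltW.
  by apply: filterS => t /ler_normlP[_]; lra.
pose c := Num.min (c12 / 2) c3.
have c0 : 0 < c by rewrite lt_min divr_gt0.
have inc (t : R) : `|t| <= c -> [/\ `|t| <= c12 / 2, `|t| <= c1, `|t| <= c2 & `|t| <= c3].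
  rewrite le_min => /andP[tc tc3].
  have /in12[? ?] : `|t| <= c12 by apply: le_trans tc _; rewrite ler_pdivrMr//; lra.
  by split.
have cI (t : R) : `|t| <= c -> I t by move=> /inc[_ /loc1[]].
have d1c (t : R) : `|t| <= c -> is_derive t 1 x1 (a1 t) by move=> /inc[_ /loc1[]].
have d2c (t : R) : `|t| <= c -> is_derive t 1 x2 (a2 t) by move=> /inc[_ _ /loc2[]].
have d3c (t : R) : `|t| <= c -> is_derive t 1 x3
    (2 * co2 (Sigma t) * a1 t - 2 * co1 (Sigma t) * a2 t) by move=> /cI /d3.
have dlc (t : R) : `|t| <= c -> is_derive t 1 l (v t) by move=> /inc[/dl].
have v2 (t : R) : `|t| <= c -> v t ^+ 2 = a1 t ^+ 2 + a2 t ^+ 2.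
  by move=> _; rewrite sqr_sqrtr// addr_ge0 ?sqr_ge0.
have mv (t : R) : `|t| <= c -> v 0 / 2 <= v t by move=> /inc[_ _ _ /vlow].
have b1 (t : R) : `|t| <= c -> `|a1 t| <= Num.max B1 B2.
  by move=> /inc[_ /loc1[_ _ _ h] _ _]; rewrite le_max h.
have b2 (t : R) : `|t| <= c -> `|a2 t| <= Num.max B1 B2.
  by move=> /inc[_ _ /loc2[_ _ _ h] _]; rewrite le_max h orbT.
have L1 (s t : R) : `|s| <= c -> `|t| <= c ->
    `|a1 s - a1 t| <= Num.max M1 M2 * `|s - t|.
  move=> /inc[_ sc _ _] /inc[_ tc _ _]; apply: le_trans (lip1 _ _ sc tc) _.
  by rewrite ler_wpM2r// le_max lexx.
have L2 (s t : R) : `|s| <= c -> `|t| <= c ->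
    `|a2 s - a2 t| <= Num.max M1 M2 * `|s - t|.
  move=> /inc[_ _ sc _] /inc[_ _ tc _]; apply: le_trans (lip2 _ _ sc tc) _.
  by rewrite ler_wpM2r// le_max lexx orbT.
have M0 : 0 <= Num.max M1 M2 by rewrite le_max M1_ge0.
have m0 : 0 < v 0 / 2 by rewrite divr_gt0.
have [rho rho0 [hmeas hN]] := spherical1_arclength Sigma a1 a2 v l c c0
  d1c d2c d3c dlc v2 _ _ M0 b1 b2 L1 L2 _ m0 mv l0.
have hl (t : R) : `|t| <= c -> v 0 / 2 * `|t| <= `|l t|.
  move=> tc; have c00 : `|0 : R| <= c by rewrite normr0 ltW.
  by have := arclength_lower _ _ _ dlc _ mv _ _ tc c00; rewrite l0 !subr0.
apply: (spherical1_ball_sandwich I Sigma l c (v 0 / 2) rho) => //.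
- by rewrite divr_ge0// sqr_ge0.
- exact: (arc_chord_expansion Sigma a1 a2 v l c c0 d1c d2c d3c dlc _ l0 v0
    _ _ _ _ T1 T2).
- by move=> d d0; exact: homeo_small_param.
Qed.

End main_estimate.

Theorem proposition3p1 (R : realType) :
  exists kappa : R, 0 < kappa /\
  forall (I : set R) (Sigma : R -> R * R * R),
    open I -> is_interval I -> I 0 ->
    embedded_curve 3 I Sigma ->
    horizontal I Sigma ->
    exists e : R -> R,
      e =o_ (0^'+) (fun r : R => r ^+ 3) /\
      \forall r \near 0^'+,
        spherical1 (hball (Sigma 0) r `&` Sigma @` I) =
        (2 * r + kappa * planar_curvature (hproj \o Sigma) 0 ^+ 2 * r ^+ 3
         + e r)%:E.
Proof.
(* Twice [1 / 72], as the arc extends on both sides of [x]. *)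
exists (1 / 36); split; first by rewrite divr_gt0.
move=> I Sigma oI _ I0 emb hor.
have main := spherical1_ball_expansion I Sigma oI I0 emb hor.
set k2 := planar_curvature _ _ ^+ 2 in main *.
set S := fun r => spherical1 (hball (Sigma 0) r `&` Sigma @` I).
exists (fun r => fine (S r) - (2 * r + 1 / 36 * k2 * r ^+ 3)); split.
(* The two-sided arc doubles the error, hence [e / 2]. *)
- apply/eqoP => e e0; have e20 : 0 < e / 2 by rewrite divr_gt0.
  have [r0 r00 hr0] := main _ e20.
  near=> r.
  have rr0 : 0 < r <= r0.
    by apply/andP; split; near: r; [exact: nbhs_right_gt|exact: nbhs_right_le].
  have /andP[] := hr0 r rr0.
  rewrite -/(S r) => h1 h2.
  have fS : S r \is a fin_num.
    by rewrite fin_numE gt_eqF ?(lt_le_trans _ h1) ?ltNyr// lt_eqF// (le_lt_trans h2) ?ltry.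
  rewrite -(fineK fS) !lee_fin in h1 h2.
  have r3 : 0 <= r ^+ 3 by rewrite exprn_ge0.
  rewrite (ger0_norm r3) ler_norml; apply/andP; split.
    by move: h1; rewrite mulrBl; lra.
  by move: h2; rewrite mulrDl; lra.
(* Any positive tolerance serves: only finiteness of the measure is needed for [fine] to be
   faithful. *)
- have [r0 r00 hr0] := main 1 ltr01.
  near=> r.
  have rr0 : 0 < r <= r0.
    by apply/andP; split; near: r; [exact: nbhs_right_gt|exact: nbhs_right_le].
  have /andP[] := hr0 r rr0.
  rewrite -/(S r) => h1 h2.
  have fS : S r \is a fin_num.
    by rewrite fin_numE gt_eqF ?(lt_le_trans _ h1) ?ltNyr// lt_eqF// (le_lt_trans h2) ?ltry.
  by rewrite -/(S r) addrC subrK fineK.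
Unshelve. all: by end_near.
Qed.
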